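(* Let $r>0$ be real and $q=e^{-\pi\sqrt r}$. Then $$\sum_{n=-\infty}^{\infty}(-1)^n q^{2n^2+n}=q^{1/24}\,\eta(q^4)\,\sqrt[12]{\frac{4(1-k_r^2)}{k_r}} .$$
   Context: $\eta(q):=\prod_{n=1}^\infty(1-q^n)$ for $|q|<1$ (no factor $q^{1/24}$). $K(x)=\frac{\pi}{2}\,{}_2F_1(\frac12,\frac12;1;x^2)$, $|x|<1$, is the complete elliptic integral of the first kind. For $r>0$, the elliptic singular modulus $k_r\in(0,1)$ is the solution of $K(\sqrt{1-k_r^2})/K(k_r)=\sqrt r$; equivalently $k_r=\theta_2(q)^2/\theta_3(q)^2$ with $q=e^{-\pi\sqrt r}$, $\theta_2(q)=\sum_{n\in\mathbb Z}q^{(n+1/2)^2}$, $\theta_3(q)=\sum_{n\in\mathbb Z}q^{n^2}$. Roots are positive real roots. *)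

(* Defs.v *)
(* Stdlib real numbers with Coquelicot. *)
From Stdlib Require Import Reals ZArith.
From Coquelicot Require Import Coquelicot.
Open Scope R_scope.

(* The two half-series must converge separately. *)
Definition is_series_Z (f : Z -> R) (l : R) : Prop :=
  exists l1 l2 : R,
    is_series (fun n : nat => f (Z.of_nat n)) l1 /\
    is_series (fun n : nat => f (- Z.of_nat (S n))%Z) l2 /\
    l = l1 + l2.

(* Normalised without the factor q^(1/24). *)
Definition eta (q : R) : R :=
  real (Lim_seq (fun N : nat => prod_f_R0 (fun n : nat => 1 - q ^ S n) N)).

Fixpoint pochhammer (a : R) (n : nat) : R :=
  match n with
  | O => 1
  | S m => pochhammer a m * (a + INR m)
  end.

Definition hyp2F1 (a b c z : R) : R :=
  PSeries (fun n : nat =>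
    pochhammer a n * pochhammer b n / (pochhammer c n * INR (fact n))) z.

(* The argument is the modulus x, not the parameter x^2. *)
Definition ellK (x : R) : R := PI / 2 * hyp2F1 (1/2) (1/2) 1 (x ^ 2).

Definition is_singular_modulus (r k : R) : Prop :=
  0 < k < 1 /\ ellK (sqrt (1 - k ^ 2)) / ellK k = sqrt r.

(* [iota] is definite description: it returns the solution as soon as the
   solution exists and is unique (lemma [iota_correct]). *)
Definition singular_modulus (r : R) : R :=
  iota (is_singular_modulus r).

(* Main.v *)
Require Import Defs.
From Stdlib Require Import Reals ZArith.
From Coquelicot Require Import Coquelicot.
From Stdlib Require Import Lra Lia.
Open Scope R_scope.

(** By the Jacobi triple product the series equals
    [eta(q^4) * prod (1 - q^(2n-1))], and if [k = theta2^2 / theta3^2] then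
    [4 (1 - k^2) / k = q^(-1/2) prod (1 - q^(2n-1))^12] by the product formulas
    of the theta functions.  It remains to see that this [k] is the singular
    modulus.  Replacing [q] by [q^2] turns [k] into [(1 - k') / (1 + k')], which
    doubles [K'/K] by Landen's transformation.  Iterating sends [k] to [0], where
    [K = pi/2 + o(1)] and [K' = ln (1/k) + O(1)] (from Wallis' bounds on the
    coefficients) force [K'/K = - ln q / pi].  Uniqueness holds because [K] is
    increasing. *)

(** * Hypergeometric coefficients and Landen's transformation *)

(** The usual route identifies the modulus through K = pi/2 theta_3^2 and the inversion formula of
    the theta functions. Neither is needed here: relations between q and q^2, together with crude
    behaviour as q tends to 0, suffice. The reason is that n doublings multiply K'/K by exactly 2^n,
    while the logarithmic estimate of K' is off by an amount bounded independently of n; dividing by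
    2^n leaves an exact value. The same device proves the theta identity [theta3_sq_split]. K is
    given by a power series, whereas Landen's transformation is a substitution in an integral, so
    the series is first matched with the integral of 1/sqrt(1 - z sin^2 t). The Wallis integrals
    serve both for this and for the bounds on the coefficients. *)

Lemma sum_n_le_series (a : nat -> R) (l : R) (N : nat) :
  (forall n, 0 <= a n) -> is_series a l -> sum_n a N <= l.
Proof.
  intros Ha Hs.
  apply (is_lim_seq_incr_compare (sum_n a) l); [exact Hs|].
  intro n. rewrite sum_Sn. unfold plus; simpl. specialize (Ha (S n)). lra.
Qed.

Lemma sum_n_Rminus (a b : nat -> R) (N : nat) :
  sum_n (fun n => a n - b n) N = sum_n a N - sum_n b N.
Proof.
  induction N as [|N IH].
  - now rewrite !sum_O.
  - rewrite !sum_Sn, IH. unfold plus; simpl. ring.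
Qed.

(** The coefficient binom(2n, n) / 4^n of (1 - u)^(-1/2). Its square is the hypergeometric
    coefficient of K. *)
Definition half_binom (n : nat) : R := pochhammer (1 / 2) n / INR (fact n).

Lemma half_binom_0 : half_binom 0 = 1.
Proof. unfold half_binom; simpl; field. Qed.

Lemma half_binom_S (n : nat) : half_binom (S n) = half_binom n * ((INR n + 1 / 2) / (INR n + 1)).
Proof.
  unfold half_binom. rewrite fact_simpl, mult_INR, S_INR. simpl pochhammer.
  field. pose proof (pos_INR n). split; [lra | apply INR_fact_neq_0].
Qed.

Lemma half_binom_pos (n : nat) : 0 < half_binom n.
Proof.
  induction n as [|n IH]; [rewrite half_binom_0; lra|].
  rewrite half_binom_S. pose proof (pos_INR n).
  apply Rmult_lt_0_compat; [assumption|]. apply Rdiv_lt_0_compat; lra.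
Qed.

Lemma half_binom_le_1 (n : nat) : half_binom n <= 1.
Proof.
  induction n as [|n IH]; [rewrite half_binom_0; lra|].
  rewrite half_binom_S. pose proof (pos_INR n). pose proof (half_binom_pos n).
  rewrite <- (Rmult_1_r 1).
  apply Rmult_le_compat; try lra.
  - apply Rdiv_le_0_compat; lra.
  - apply Rle_div_l; lra.
Qed.

Lemma pochhammer_1 (n : nat) : pochhammer 1 n = INR (fact n).
Proof.
  induction n as [|n IH]; [reflexivity|].
  rewrite fact_simpl, mult_INR, S_INR. simpl pochhammer. rewrite IH. ring.
Qed.

(** K up to the factor pi/2, as a function of the parameter z = k^2 rather than of the modulus k. *)
Definition hyp (z : R) : R := hyp2F1 (1 / 2) (1 / 2) 1 z.

Lemma hyp_PSeries (z : R) : hyp z = PSeries (fun n => half_binom n ^ 2) z.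
Proof.
  apply PSeries_ext. intro n. unfold half_binom. rewrite pochhammer_1.
  field. apply INR_fact_neq_0.
Qed.

Lemma CV_radius_unit_bounded (a : nat -> R) (x : R) :
  (forall n, Rabs (a n) <= 1) -> Rabs x < 1 -> Rbar_lt (Rabs x) (CV_radius a).
Proof.
  intros Ha Hx. apply (Rbar_lt_le_trans _ 1); [exact Hx|].
  apply (proj1 (CV_radius_bounded a)).
  exists 1. intro n. now rewrite pow1, Rmult_1_r.
Qed.

Lemma is_series_PSeries_unit (a : nat -> R) (x : R) :
  (forall n, Rabs (a n) <= 1) -> 0 <= x < 1 ->
  is_series (fun n => a n * x ^ n) (PSeries a x).
Proof.
  intros Ha Hx. apply Series_correct.
  apply (ex_series_ext (fun n => scal (pow_n x n) (a n))).
  { intro n. rewrite pow_n_pow. unfold scal; simpl; unfold mult; simpl. ring. }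
  apply (CV_disk_correct a x), CV_disk_inside, CV_radius_unit_bounded; auto.
  rewrite Rabs_pos_eq; lra.
Qed.

Lemma half_binom_abs (n : nat) : Rabs (half_binom n) <= 1.
Proof.
  rewrite Rabs_pos_eq by (apply Rlt_le, half_binom_pos). apply half_binom_le_1.
Qed.

Lemma half_binom_sq_abs (n : nat) : Rabs (half_binom n ^ 2) <= 1.
Proof.
  pose proof (half_binom_pos n). pose proof (half_binom_le_1 n).
  rewrite Rabs_pos_eq by (apply pow2_ge_0). nra.
Qed.

Lemma is_series_hyp (z : R) :
  0 <= z < 1 -> is_series (fun n => half_binom n ^ 2 * z ^ n) (hyp z).
Proof.
  intro Hz. rewrite hyp_PSeries. apply is_series_PSeries_unit; auto using half_binom_sq_abs.
Qed.

(** The recurrence (n+1) b_(n+1) = (n + 1/2) b_n read on generating functions; it is the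
    differential equation of (1 - u)^(-1/2). *)
Lemma half_binom_PSeries_ode (u : R) :
  Rabs u < 1 -> (1 - u) * PSeries (PS_derive half_binom) u = PSeries half_binom u / 2.
Proof.
  intro Hu.
  assert (Hc : Rbar_lt (Rabs u) (CV_radius (PS_derive half_binom))).
  { rewrite CV_radius_derive. apply CV_radius_unit_bounded; auto using half_binom_abs. }
  assert (H1 : ex_pseries (PS_derive half_binom) u)
    by now apply CV_disk_correct, CV_disk_inside.
  transitivity (PSeries (PS_derive half_binom) u - PSeries (PS_incr_1 (PS_derive half_binom)) u).
  { rewrite PSeries_incr_1. ring. }
  rewrite <- PSeries_minus by auto using ex_pseries_incr_1.
  replace (PSeries half_binom u / 2) with (/ 2 * PSeries half_binom u) by field.
  rewrite <- PSeries_scal. apply PSeries_ext. intros [|n];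
  unfold PS_minus, PS_plus, PS_opp, PS_scal, PS_incr_1, PS_derive, plus, opp, scal,
    mult, zero; simpl; unfold mult; simpl.
  - rewrite half_binom_S, half_binom_0. simpl. field.
  - fold (INR (S n)). change (match n with 0%nat => 1 | S _ => INR n + 1 end) with (INR (S n)).
    rewrite (half_binom_S (S n)). rewrite S_INR. pose proof (pos_INR n). field. lra.
Qed.

(** By the differential equation, (1 - u) f(u)^2 has derivative 0, so it keeps its value 1 at u = 0;
    f >= 1 selects the positive root. *)
Lemma is_series_inv_sqrt (u : R) :
  0 <= u < 1 -> is_series (fun n => half_binom n * u ^ n) (/ sqrt (1 - u)).
Proof.
  intro Hu.
  enough (E : PSeries half_binom u = / sqrt (1 - u)).
  { rewrite <- E. apply is_series_PSeries_unit; auto using half_binom_abs. }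
  assert (Hs := is_series_PSeries_unit half_binom u half_binom_abs Hu).
  assert (Hp : 1 <= PSeries half_binom u).
  { pose proof (sum_n_le_series _ _ 0 (fun n => Rmult_le_pos _ _ (Rlt_le _ _ (half_binom_pos n)) (pow_le u n (proj1 Hu))) Hs) as H.
    rewrite sum_O, half_binom_0 in H. simpl in H. lra. }
  assert (E : (1 - u) * PSeries half_binom u ^ 2 = 1).
  { destruct (Req_dec u 0) as [->|Hu0].
    { rewrite PSeries_0, half_binom_0. ring. }
    pose proof (eq_is_derive (fun t => (1 - t) * PSeries half_binom t ^ 2) 0 u) as H.
    rewrite <- H; [rewrite PSeries_0, half_binom_0; ring | | lra].
    intros t Ht. assert (Habs : Rabs t < 1) by (rewrite Rabs_pos_eq; lra).
    evar_last.
    { apply (is_derive_mult (fun t => 1 - t) (fun t => PSeries half_binom t ^ 2)).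
      - auto_derive; reflexivity.
      - apply is_derive_pow, is_derive_PSeries, CV_radius_unit_bounded; auto using half_binom_abs.
      - intros; apply Rmult_comm. }
    unfold plus, mult, zero; simpl.
    pose proof (half_binom_PSeries_ode t Habs) as Ho.
    replace ((1 - t) * ((1 + 1) * PSeries (PS_derive half_binom) t * (PSeries half_binom t * 1)))
      with (((1 - t) * PSeries (PS_derive half_binom) t) * (2 * PSeries half_binom t)) by ring.
    rewrite Ho. field. }
  assert (0 < sqrt (1 - u)) by (apply sqrt_lt_R0; lra).
  assert (E2 : (sqrt (1 - u) * PSeries half_binom u) = 1).
  { apply Rsqr_inj; [|lra|].
    - apply Rmult_le_pos; lra.
    - rewrite Rsqr_mult, Rsqr_sqrt by lra. unfold Rsqr. lra. }
  apply Rmult_eq_reg_l with (sqrt (1 - u)); [rewrite E2; field; lra | lra].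
Qed.

(** * Wallis integrals and the size of the coefficients *)

Lemma continuous_sin_pow (n : nat) (t : R) : continuous (fun t => sin t ^ n) t.
Proof. apply (@ex_derive_continuous R_AbsRing R_NormedModule). auto_derive. exact I. Qed.

(** The upper limit is left free because Landen's substitution needs PI as well as PI / 2. *)
Definition wallis (b : R) (n : nat) : R := RInt (fun t => sin t ^ n) 0 b.

Lemma ex_RInt_sin_pow (a b : R) (n : nat) : ex_RInt (fun t => sin t ^ n) a b.
Proof. apply (@ex_RInt_continuous R_CompleteNormedModule). intros. apply continuous_sin_pow. Qed.

Lemma wallis_0 (b : R) : wallis b 0 = b.
Proof. unfold wallis. simpl. rewrite RInt_const. unfold scal; simpl; unfold mult; simpl. ring. Qed.

(** Integration by parts, with antiderivative cos t sin^(n+1) t. The condition on b kills the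
    boundary term at both PI / 2 and PI. *)
Lemma wallis_rec (b : R) (n : nat) :
  sin b * cos b = 0 -> (INR n + 2) * wallis b (S (S n)) = (INR n + 1) * wallis b n.
Proof.
  intro Hb.
  assert (H : is_RInt (fun t => (INR n + 1) * sin t ^ n - (INR n + 2) * sin t ^ S (S n)) 0 b
                (minus (cos b * sin b ^ S n) (cos 0 * sin 0 ^ S n))).
  { apply (is_RInt_derive (fun t => cos t * sin t ^ S n)).
    - intros t _. auto_derive; [exact I|].
      replace (match n with 0%nat => 1 | S _ => INR n + 1 end) with (INR n + 1)
        by (destruct n; simpl; ring).
      simpl. pose proof (sin2_cos2 t) as H. unfold Rsqr in H.
      replace (sin t * (sin t * sin t ^ n)) with ((1 - cos t * cos t) * sin t ^ n)
        by (rewrite <- H; ring).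
      assert (sin t * sin t = 1 - cos t * cos t) by lra.
      transitivity (- (sin t * sin t) * sin t ^ n + cos t * cos t * ((INR n + 1) * sin t ^ n)).
      + simpl. ring.
      + rewrite H0. ring.
    - intros t _. apply (@ex_derive_continuous R_AbsRing R_NormedModule). auto_derive. exact I. }
  assert (H' : is_RInt (fun t => (INR n + 1) * sin t ^ n - (INR n + 2) * sin t ^ S (S n)) 0 b
                (minus (scal (INR n + 1) (wallis b n)) (scal (INR n + 2) (wallis b (S (S n)))))).
  { apply (is_RInt_minus (V := R_NormedModule)); apply (is_RInt_scal (V := R_NormedModule));
      apply (RInt_correct (V := R_CompleteNormedModule)), ex_RInt_sin_pow. }
  apply (@is_RInt_unique R_CompleteNormedModule) in H. apply (@is_RInt_unique R_CompleteNormedModule) in H'. rewrite H in H'.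
  unfold minus, plus, opp, scal in H'; simpl in H'; unfold mult in H'; simpl in H'.
  rewrite sin_0 in H'.
  replace (cos b * (sin b * sin b ^ n)) with (sin b * cos b * sin b ^ n) in H' by ring.
  rewrite Hb in H'. lra.
Qed.

Lemma wallis_even (b : R) (n : nat) :
  sin b * cos b = 0 -> wallis b (2 * n) = b * half_binom n.
Proof.
  intro Hb. induction n as [|n IH].
  - simpl. rewrite wallis_0, half_binom_0. ring.
  - pose proof (wallis_rec b (2 * n) Hb) as H. rewrite IH in H.
    replace (2 * S n)%nat with (S (S (2 * n))) by lia.
    rewrite mult_INR in H. simpl (INR 2) in H. rewrite half_binom_S.
    pose proof (pos_INR n).
    apply Rmult_eq_reg_l with ((1 + 1) * INR n + 2); [|lra]. rewrite H. field. lra.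
Qed.

Lemma wallis_decr (n : nat) : wallis (PI / 2) (S n) <= wallis (PI / 2) n.
Proof.
  pose proof PI_RGT_0.
  apply RInt_le; [lra | apply ex_RInt_sin_pow | apply ex_RInt_sin_pow |].
  intros t Ht. simpl. assert (0 <= sin t) by (apply sin_ge_0; lra).
  pose proof (SIN_bound t). rewrite <- (Rmult_1_l (sin t ^ n)) at 2.
  apply Rmult_le_compat_r; [now apply pow_le | lra].
Qed.

Lemma wallis_1 : wallis (PI / 2) 1 = 1.
Proof.
  unfold wallis. apply (@is_RInt_unique R_CompleteNormedModule).
  evar_last.
  { apply (is_RInt_derive (fun t => - cos t) (fun t => sin t ^ 1)).
    - intros t _. auto_derive; [exact I| ring].
    - intros; apply continuous_sin_pow. }
  rewrite cos_PI2, cos_0. unfold minus, plus, opp; simpl. ring.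
Qed.

(** The recurrence makes the left side independent of n. Combined with [wallis_decr], it confines
    the square of a single Wallis integral, hence that of [half_binom]. *)
Lemma wallis_product (n : nat) :
  (INR n + 1) * wallis (PI / 2) n * wallis (PI / 2) (S n) = PI / 2.
Proof.
  induction n as [|n IH].
  - rewrite wallis_0, wallis_1. simpl. ring.
  - etransitivity; [|exact IH]. rewrite S_INR.
    replace ((INR n + 1 + 1) * wallis (PI / 2) (S n) * wallis (PI / 2) (S (S n)))
      with (wallis (PI / 2) (S n) * ((INR n + 2) * wallis (PI / 2) (S (S n)))) by ring.
    rewrite wallis_rec; [ring|]. rewrite cos_PI2. ring.
Qed.

Lemma half_binom_sq_lower (n : nat) : / (PI * (INR n + 1)) <= half_binom n ^ 2.
Proof.
  pose proof PI_RGT_0 as Hpi. pose proof (pos_INR n) as Hn. pose proof (half_binom_pos n) as Hb.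
  pose proof (wallis_product (2 * n)) as H. pose proof (wallis_decr (2 * n)) as H1.
  rewrite (wallis_even (PI / 2) n) in * by (rewrite cos_PI2; ring).
  rewrite mult_INR in H. simpl (INR 2) in H.
  set (w := wallis (PI / 2) (S (2 * n))) in *.
  apply Rmult_le_reg_l with (PI * (INR n + 1)); [nra|].
  rewrite Rinv_r by nra.
  assert (PI / 2 <= (2 * INR n + 1) * (PI / 2 * half_binom n) * (PI / 2 * half_binom n)).
  { eapply Rle_trans; [apply Req_le, eq_sym, H|]. apply Rmult_le_compat_l; [|assumption].
    apply Rmult_le_pos; [lra|]. apply Rmult_le_pos; lra. }
  assert (1 <= (2 * INR n + 1) * half_binom n * (PI / 2 * half_binom n)).
  { apply Rmult_le_reg_l with (PI / 2); [lra|]. lra. }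
  assert (0 <= half_binom n * (PI * half_binom n)) by (apply Rmult_le_pos; nra).
  nra.
Qed.

(** The index is shifted so that both bounds involve the same term 1 / (PI (n + 1)). Both comparison
    series then sum to - ln (1 - z) / PI, and the two estimates of [hyp] differ only by the initial
    term 1. *)
Lemma half_binom_sq_upper (n : nat) : half_binom (S n) ^ 2 <= / (PI * (INR n + 1)).
Proof.
  pose proof PI_RGT_0 as Hpi. pose proof (pos_INR n) as Hn. pose proof (half_binom_pos (S n)) as Hb.
  pose proof (wallis_product (2 * n + 1)) as H. pose proof (wallis_decr (2 * n + 1)) as H1.
  replace (S (2 * n + 1)) with (2 * S n)%nat in * by lia.
  rewrite (wallis_even (PI / 2) (S n)) in * by (rewrite cos_PI2; ring).
  rewrite plus_INR, mult_INR in H. simpl (INR 2) in H. simpl (INR 1) in H.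
  set (w := wallis (PI / 2) (2 * n + 1)) in *.
  apply Rmult_le_reg_l with (PI * (INR n + 1)); [nra|].
  rewrite Rinv_r by nra.
  assert ((2 * INR n + 1 + 1) * (PI / 2 * half_binom (S n)) * (PI / 2 * half_binom (S n)) <= PI / 2).
  { eapply Rle_trans; [|apply Req_le, H]. apply Rmult_le_compat_r; [nra|].
    apply Rmult_le_compat_l; [lra|assumption]. }
  apply Rmult_le_reg_l with (PI / 2); [lra|]. nra.
Qed.

(** * The trigonometric integral and Landen's transformation *)

Lemma inv_sqrt_sin_denom (z t : R) : 0 <= z < 1 -> 0 <= z * sin t ^ 2 <= z.
Proof. intros Hz. pose proof (SIN_bound t). assert (sin t ^ 2 <= 1) by nra. pose proof (pow2_ge_0 (sin t)). nra. Qed.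

Lemma continuous_inv_sqrt_sin (z t : R) :
  0 <= z < 1 -> continuous (fun t => / sqrt (1 - z * sin t ^ 2)) t.
Proof.
  intro Hz. pose proof (inv_sqrt_sin_denom z t Hz).
  apply (@ex_derive_continuous R_AbsRing R_NormedModule). auto_derive.
  simpl in *. assert (0 < 1 - z * (sin t * (sin t * 1))) by lra.
  repeat split; [lra| apply Rgt_not_eq, sqrt_lt_R0; lra].
Qed.

Lemma is_RInt_sum_n (f : nat -> R -> R) (I : nat -> R) (a b : R) (N : nat) :
  (forall n, is_RInt (f n) a b (I n)) ->
  is_RInt (fun t => sum_n (fun n => f n t) N) a b (sum_n I N).
Proof.
  intro H. induction N as [|N IH].
  - apply (is_RInt_ext (f 0%nat)); [intros; now rewrite sum_O | rewrite sum_O; apply H].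
  - rewrite sum_Sn.
    apply (is_RInt_ext (fun t => plus (sum_n (fun n => f n t) N) (f (S N) t))).
    { intros. now rewrite sum_Sn. }
    now apply (is_RInt_plus (V := R_NormedModule)).
Qed.

(** Termwise integration of the binomial series: [wallis_even] supplies a second factor
    [half_binom n], which squares the coefficient. *)
Lemma RInt_inv_sqrt_sin (b z : R) :
  0 <= b -> sin b * cos b = 0 -> 0 <= z < 1 ->
  RInt (fun t => / sqrt (1 - z * sin t ^ 2)) 0 b = b * hyp z.
Proof.
  intros Hb Hsc Hz.
  set (g := fun t => / sqrt (1 - z * sin t ^ 2)).
  assert (Hg : is_RInt g 0 b (RInt g 0 b)).
  { apply (RInt_correct (V := R_CompleteNormedModule)), (@ex_RInt_continuous R_CompleteNormedModule).
    intros; now apply continuous_inv_sqrt_sin. }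
  set (J := RInt g 0 b) in *.
  assert (HS : forall N, is_RInt (fun t => sum_n (fun n => half_binom n * (z * sin t ^ 2) ^ n) N) 0 b
                  (sum_n (fun n => b * (half_binom n ^ 2 * z ^ n)) N)).
  { intro N. apply is_RInt_sum_n. intro n.
    replace (b * (half_binom n ^ 2 * z ^ n)) with (scal (half_binom n * z ^ n) (wallis b (2 * n))).
    2:{ rewrite wallis_even by assumption. unfold scal; simpl; unfold mult; simpl. ring. }
    apply (is_RInt_ext (fun t => scal (half_binom n * z ^ n) (sin t ^ (2 * n)))).
    { intros. rewrite Rpow_mult_distr, <- pow_mult. unfold scal; simpl; unfold mult; simpl. ring. }
    apply (is_RInt_scal (V := R_NormedModule)).
    apply (RInt_correct (V := R_CompleteNormedModule)), ex_RInt_sin_pow. }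
  (* Uniform convergence: the coefficients are positive and z sin^2 t <= z, so the tail at any t is
     at most the tail at z. *)
  assert (Hbound : forall N, Rabs (J - sum_n (fun n => b * (half_binom n ^ 2 * z ^ n)) N)
                     <= b * (/ sqrt (1 - z) - sum_n (fun n => half_binom n * z ^ n) N)).
  { intro N. replace (b * (/ sqrt (1 - z) - sum_n (fun n => half_binom n * z ^ n) N))
      with ((b - 0) * (/ sqrt (1 - z) - sum_n (fun n => half_binom n * z ^ n) N)) by ring.
    apply (norm_RInt_le_const (V := R_NormedModule)
       (fun t => minus (g t) (sum_n (fun n => half_binom n * (z * sin t ^ 2) ^ n) N)) 0 b
       (minus J (sum_n (fun n => b * (half_binom n ^ 2 * z ^ n)) N))); [assumption | |].
    2:{ now apply (is_RInt_minus (V := R_NormedModule)). }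
    intros t _. pose proof (inv_sqrt_sin_denom z t Hz) as Hu.
    set (u := z * sin t ^ 2) in *. unfold norm, minus, plus, opp; simpl. unfold abs; simpl.
    assert (Hsu : is_series (fun n => half_binom n * u ^ n) (/ sqrt (1 - u)))
      by (apply is_series_inv_sqrt; lra).
    assert (Hsz := is_series_inv_sqrt z Hz).
    pose proof (sum_n_le_series _ _ N
      (fun n => Rmult_le_pos _ _ (Rlt_le _ _ (half_binom_pos n)) (pow_le u n (proj1 Hu))) Hsu) as H1.
    (* The termwise difference is nonnegative, so its partial sums stay below its total; rearranged,
       this compares the two tails. *)
    assert (H2 : sum_n (fun n => half_binom n * z ^ n - half_binom n * u ^ n) N <= / sqrt (1 - z) - / sqrt (1 - u)).
    { apply sum_n_le_series.
      - intro n. pose proof (half_binom_pos n). pose proof (pow_incr u z n Hu). nra.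
      - apply (is_series_minus (V := R_NormedModule)); assumption. }
    rewrite sum_n_Rminus in H2.
    unfold g. fold u. rewrite Rabs_pos_eq; lra. }
  assert (H1 : is_lim_seq (sum_n (fun n => b * (half_binom n ^ 2 * z ^ n))) J).
  { apply is_lim_seq_spec. intro eps.
    assert (Hl : is_lim_seq (fun N => b * (/ sqrt (1 - z) - sum_n (fun n => half_binom n * z ^ n) N)) 0).
    { replace (Finite 0) with (Rbar_mult b (/ sqrt (1 - z) - / sqrt (1 - z)))
        by (simpl; f_equal; ring).
      apply is_lim_seq_scal_l, is_lim_seq_minus'; [apply is_lim_seq_const|].
      apply (is_series_inv_sqrt z Hz). }
    apply is_lim_seq_spec in Hl. destruct (Hl eps) as [N HN]. exists N. intros n Hn.
    specialize (HN n Hn). specialize (Hbound n). rewrite Rabs_minus_sym.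
    apply Rabs_def2 in HN. lra. }
  assert (H2 : is_series (fun n => b * (half_binom n ^ 2 * z ^ n)) (b * hyp z))
    by (apply (is_series_scal (V := R_NormedModule) b), is_series_hyp; assumption).
  apply is_lim_seq_unique in H1. apply (is_lim_seq_unique _ (b * hyp z)) in H2.
  pose proof (eq_trans (eq_sym H1) H2) as H3. now injection H3.
Qed.

(* The substitution [sin (2 phi - t) = x sin t] maps [0, PI] onto [0, PI / 2]. *)
Lemma hyp_landen (x : R) :
  0 <= x < 1 -> hyp (4 * x / (1 + x) ^ 2) = (1 + x) * hyp (x ^ 2).
Proof.
  intro Hx. pose proof PI_RGT_0 as Hpi.
  set (y := 4 * x / (1 + x) ^ 2).
  assert (Hy : 0 <= y < 1).
  { unfold y. split.
    - apply Rdiv_le_0_compat; nra.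
    - apply Rlt_div_l; nra. }
  assert (Hx2 : 0 <= x ^ 2 < 1) by nra.
  set (D := fun t => sqrt (1 - x ^ 2 * sin t ^ 2)).
  assert (HD : forall t, 0 < D t).
  { intro t. apply sqrt_lt_R0. pose proof (inv_sqrt_sin_denom _ t Hx2). lra. }
  assert (HD2 : forall t, D t * D t = 1 - x ^ 2 * sin t ^ 2).
  { intro t. apply sqrt_sqrt. pose proof (inv_sqrt_sin_denom _ t Hx2). lra. }
  set (al := fun t => asin (x * sin t)).
  set (phi := fun t => / 2 * (t + al t)).
  set (dphi := fun t => (D t + x * cos t) / (2 * D t)).
  assert (Hxs : forall t, -1 < x * sin t < 1).
  { intro t. pose proof (SIN_bound t). nra. }
  assert (Hcos : forall t, cos (al t) = D t).
  { intro t. unfold al. rewrite cos_asin by (specialize (Hxs t); lra).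
    unfold D. f_equal. unfold Rsqr. ring. }
  assert (Hsin : forall t, sin (al t) = x * sin t).
  { intro t. apply sin_asin. specialize (Hxs t); lra. }
  (* Because D^2 - x^2 cos^2 t = 1 - x^2 > 0. *)
  assert (Hpos : forall t, 0 < D t + x * cos t).
  { intro t. specialize (HD t). specialize (HD2 t).
    pose proof (sin2_cos2 t) as H. unfold Rsqr in H.
    destruct (Rle_or_lt 0 (x * cos t)); [lra|].
    assert ((x * cos t) * (x * cos t) < D t * D t) by nra. nra. }
  (* The substitution makes the new radical linear in D and cos t; it follows from cos (2 phi) = cos
     (t + al t). *)
  assert (Hroot : forall t, sqrt (1 - y * sin (phi t) ^ 2) = (D t + x * cos t) / (1 + x)).
  { intro t.
    assert (Hc2 : 1 - 2 * sin (phi t) ^ 2 = cos t * D t - sin t * (x * sin t)).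
    { replace (1 - 2 * sin (phi t) ^ 2) with (1 - 2 * sin (phi t) * sin (phi t)) by ring.
      rewrite <- cos_2a_sin.
      replace (2 * phi t) with (t + al t) by (unfold phi; field).
      rewrite cos_plus, Hcos, Hsin. ring. }
    transitivity (sqrt (((D t + x * cos t) / (1 + x)) * ((D t + x * cos t) / (1 + x)))).
    2:{ apply sqrt_square. specialize (Hpos t). apply Rdiv_le_0_compat; lra. }
    f_equal. unfold y.
    apply Rmult_eq_reg_l with ((1 + x) ^ 2); [|nra].
    transitivity ((1 + x) ^ 2 - 2 * x * (2 * sin (phi t) ^ 2)); [field; lra|].
    transitivity ((D t + x * cos t) ^ 2); [|field; lra].
    replace (2 * sin (phi t) ^ 2) with (1 - (cos t * D t - sin t * (x * sin t))) by lra.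
    pose proof (HD2 t) as E. pose proof (sin2_cos2 t) as H. unfold Rsqr in H.
    replace ((D t + x * cos t) ^ 2) with (D t * D t + 2 * x * cos t * D t + x ^ 2 * (cos t * cos t)) by ring.
    rewrite E. replace (cos t * cos t) with (1 - sin t * sin t) by lra. ring. }
  assert (Hphi : forall t, is_derive phi t (dphi t)).
  { intro t. unfold phi, dphi, al.
    assert (Ha : is_derive (fun t => asin (x * sin t)) t (x * cos t * / D t)).
    { evar_last.
      { apply (is_derive_comp asin (fun t => x * sin t)).
        - apply is_derive_Reals, (derive_pt_eq_1 _ _ _ (derivable_pt_asin _ (Hxs t))), derive_pt_asin.
        - auto_derive; [exact I| reflexivity]. }
      unfold scal; simpl; unfold mult; simpl. unfold D.
      replace (1 - (x * sin t)²) with (1 - x ^ 2 * sin t ^ 2)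
        by (unfold Rsqr; ring).
      specialize (HD t). unfold D in HD. field. lra. }
    evar_last.
    { apply (is_derive_scal (fun t => t + asin (x * sin t)) t (/ 2)).
      apply (is_derive_plus (K := R_AbsRing) (V := R_NormedModule) (fun t => t)); [apply is_derive_id | exact Ha]. }
    unfold plus, one; simpl. specialize (HD t). field. lra. }
  assert (Hcd : forall t, continuous dphi t).
  { intro t. unfold dphi, D. pose proof (HD t) as H1. unfold D in H1. pose proof (inv_sqrt_sin_denom _ t Hx2).
    apply (@ex_derive_continuous R_AbsRing R_NormedModule). auto_derive.
    simpl in *. repeat split; try lra. unfold Rminus in H1. apply Rgt_not_eq; lra. }
  pose proof (RInt_comp (V := R_CompleteNormedModule) (fun u => / sqrt (1 - y * sin u ^ 2)) phi dphi 0 PI) as Hsub.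
  specialize (Hsub (fun t _ => continuous_inv_sqrt_sin y (phi t) Hy)
                   (fun t _ => conj (Hphi t) (Hcd t))).
  assert (E0 : phi 0 = 0) by (unfold phi, al; rewrite sin_0, Rmult_0_r, asin_0; field).
  assert (E1 : phi PI = PI / 2) by (unfold phi, al; rewrite sin_PI, Rmult_0_r, asin_0; field).
  rewrite E0, E1, (RInt_inv_sqrt_sin (PI / 2) y) in Hsub;
    [| lra | rewrite cos_PI2; ring | assumption].
  (* The factor D t + x cos t of [dphi] cancels against the radical, leaving a constant multiple of
     1 / D. *)
  rewrite (RInt_ext _ (fun t => scal ((1 + x) / 2) (/ sqrt (1 - x ^ 2 * sin t ^ 2)))) in Hsub.
  2:{ intros t _. rewrite Hroot.
      change (dphi t * / ((D t + x * cos t) / (1 + x)) = (1 + x) / 2 * / D t). unfold dphi.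
      specialize (Hpos t). specialize (HD t). field. lra. }
  assert (E : (1 + x) / 2 * RInt (fun t => / sqrt (1 - x ^ 2 * sin t ^ 2)) 0 PI = PI / 2 * hyp y).
  { rewrite <- Hsub. symmetry. apply (RInt_scal (V := R_CompleteNormedModule)).
    apply (@ex_RInt_continuous R_CompleteNormedModule).
    intros. now apply continuous_inv_sqrt_sin. }
  rewrite (RInt_inv_sqrt_sin PI (x ^ 2)) in E; [| lra | rewrite sin_PI; ring | assumption].
  apply Rmult_eq_reg_l with (PI / 2); [|lra]. rewrite <- E. field.
Qed.

(** * Logarithmic growth of the hypergeometric function *)

Lemma is_series_le (a b : nat -> R) (la lb : R) :
  (forall n, a n <= b n) -> is_series a la -> is_series b lb -> la <= lb.
Proof.
  intros Hab Ha Hb.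
  assert (H : sum_n (fun n => b n - a n) 0 <= lb - la).
  { apply sum_n_le_series; [intro n; specialize (Hab n); lra|].
    now apply (is_series_minus (V := R_NormedModule)). }
  assert (H0 : is_series (fun n => b n - a n) (lb - la))
    by now apply (is_series_minus (V := R_NormedModule)).
  rewrite sum_O in H. specialize (Hab 0%nat). lra.
Qed.

Lemma hyp_ge_1 (z : R) : 0 <= z < 1 -> 1 <= hyp z.
Proof.
  intro Hz.
  pose proof (sum_n_le_series _ _ 0 (fun n => Rmult_le_pos _ _ (pow2_ge_0 (half_binom n)) (pow_le z n (proj1 Hz)))
    (is_series_hyp z Hz)) as H.
  rewrite sum_O, half_binom_0 in H. simpl in H. lra.
Qed.

Lemma hyp_increasing (y z : R) : 0 <= y -> y < z -> z < 1 -> hyp y < hyp z.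
Proof.
  intros Hy Hyz Hz.
  (* The terms 0 and 1 alone contribute (z - y) / 4, which gives strictness. *)
  assert (H : sum_n (fun n => half_binom n ^ 2 * z ^ n - half_binom n ^ 2 * y ^ n) 1 <= hyp z - hyp y).
  { apply sum_n_le_series.
    - intro n. assert (y ^ n <= z ^ n) by (apply pow_incr; lra).
      pose proof (pow2_ge_0 (half_binom n)). nra.
    - apply (is_series_minus (V := R_NormedModule)); apply is_series_hyp; lra. }
  rewrite sum_Sn, sum_O, half_binom_S, half_binom_0 in H. unfold plus in H; simpl in H. lra.
Qed.

(** Crude, but with [hyp_ge_1] it squeezes [hyp] to 1 at 0. *)
Lemma hyp_le_geom (z : R) : 0 <= z < 1 -> hyp z <= / (1 - z).
Proof.
  intro Hz. apply (is_series_le (fun n => half_binom n ^ 2 * z ^ n) (fun n => z ^ n)).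
  - intro n. pose proof (half_binom_sq_abs n) as H. rewrite Rabs_pos_eq in H by apply pow2_ge_0.
    pose proof (pow_le z n (proj1 Hz)). nra.
  - now apply is_series_hyp.
  - apply is_series_geom. rewrite Rabs_pos_eq; lra.
Qed.

Lemma is_series_ln (z : R) :
  0 <= z < 1 -> is_series (fun n => z ^ S n / (INR n + 1)) (- ln (1 - z)).
Proof.
  intro Hz.
  assert (Ha : forall n : nat, Rabs ((fun _ => 1) n) <= 1) by (intro; rewrite Rabs_R1; lra).
  assert (Hc : Rbar_lt (Rabs z) (CV_radius (fun _ => 1)))
    by (apply CV_radius_unit_bounded; [exact Ha| rewrite Rabs_pos_eq; lra]).
  assert (E : PSeries (PS_Int (fun _ => 1)) z = - ln (1 - z)).
  { rewrite <- RInt_PSeries by assumption.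
    apply (@is_RInt_unique R_CompleteNormedModule).
    apply (is_RInt_ext (fun t => / (1 - t))).
    { intros t. rewrite Rmin_left, Rmax_right by lra. intro Ht.
      symmetry. apply is_series_unique.
      apply (is_series_ext (fun n => t ^ n)); [intro; symmetry; apply Rmult_1_l|].
      apply is_series_geom. rewrite Rabs_pos_eq; lra. }
    evar_last.
    { apply (is_RInt_derive (fun t => - ln (1 - t))).
      - intros t. rewrite Rmin_left, Rmax_right by lra. intro Ht.
        auto_derive; [lra | field; lra].
      - intros t. rewrite Rmin_left, Rmax_right by lra. intro Ht.
        apply (@ex_derive_continuous R_AbsRing R_NormedModule). auto_derive. lra. }
    unfold minus, plus, opp; simpl. rewrite Rminus_0_r, ln_1. ring. }
  rewrite <- E.
  (* [PS_Int] has constant coefficient 0, so dropping that term only re-indexes the series. *)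
  apply (is_series_ext (fun n => (fun n => PS_Int (fun _ => 1) n * z ^ n) (S n))).
  { intro n. unfold PS_Int. cbn [pow]. simpl Init.Nat.pred. rewrite S_INR.
    match goal with |- ?a = ?b => change (@eq R a b) end. field. pose proof (pos_INR n); lra. }
  apply (is_series_incr_1 (V := R_NormedModule) (fun n => PS_Int (fun _ => 1) n * z ^ n)).
  replace (plus _ _) with (PSeries (PS_Int (fun _ => 1)) z)
    by (rewrite (eq_refl : PS_Int (fun _ => 1) 0 = 0), Rmult_0_l; apply eq_sym, Rplus_0_r).
  apply is_series_PSeries_unit; [|assumption].
  intros [|n]; unfold PS_Int; [rewrite Rabs_R0; lra|].
  simpl Init.Nat.pred. pose proof (pos_INR n).
  assert (0 < / INR (S n) <= 1).
  { rewrite S_INR. split; [apply Rinv_0_lt_compat; lra|].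
    rewrite <- Rinv_1 at 2. apply Rinv_le_contravar; lra. }
  rewrite Rabs_pos_eq; unfold Rdiv; lra.
Qed.

Lemma hyp_ln_lower (z : R) : 0 <= z < 1 -> - ln (1 - z) / PI <= hyp z.
Proof.
  intro Hz. pose proof PI_RGT_0.
  apply (is_series_le (fun n => / PI * (z ^ S n / (INR n + 1))) (fun n => half_binom n ^ 2 * z ^ n)).
  - intro n. apply Rle_trans with (/ (PI * (INR n + 1)) * z ^ n).
    + pose proof (pos_INR n). pose proof (pow_le z n (proj1 Hz)).
      replace (/ PI * (z ^ S n / (INR n + 1))) with (/ (PI * (INR n + 1)) * z ^ S n) by (field; lra).
      apply Rmult_le_compat_l; [apply Rlt_le, Rinv_0_lt_compat; nra|]. simpl. nra.
    + apply Rmult_le_compat_r; [apply pow_le; lra | apply half_binom_sq_lower].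
  - replace (- ln (1 - z) / PI) with (/ PI * - ln (1 - z)) by (field; lra).
    apply (is_series_scal (V := R_NormedModule)), is_series_ln, Hz.
  - now apply is_series_hyp.
Qed.

Lemma hyp_ln_upper (z : R) : 0 <= z < 1 -> hyp z <= 1 - ln (1 - z) / PI.
Proof.
  intro Hz. pose proof PI_RGT_0.
  enough (hyp z - 1 <= - ln (1 - z) / PI) by lra.
  apply (is_series_le (fun n => (fun n => half_binom n ^ 2 * z ^ n) (S n)) (fun n => / PI * (z ^ S n / (INR n + 1)))).
  - intro n. pose proof (pos_INR n).
    replace (/ PI * (z ^ S n / (INR n + 1))) with (/ (PI * (INR n + 1)) * z ^ S n) by (field; lra).
    apply Rmult_le_compat_r; [apply pow_le; lra | apply half_binom_sq_upper].
  - apply (is_series_incr_1 (V := R_NormedModule) (fun n => half_binom n ^ 2 * z ^ n)).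
    replace (plus _ _) with (hyp z) by (rewrite half_binom_0; unfold plus; simpl; ring).
    now apply is_series_hyp.
  - replace (- ln (1 - z) / PI) with (/ PI * - ln (1 - z)) by (field; lra).
    apply (is_series_scal (V := R_NormedModule)), is_series_ln, Hz.
Qed.

(** * The Jacobi triple product *)

(* [ring] rejects the type [AbelianMonoid.sort R_AbelianMonoid] of [sum_n]; adding
   [0] restores [R]. *)
Ltac eqR := apply (Rplus_eq_reg_l 0).

(** The q-Pochhammer symbol of - a; with the plus sign the factors of the triple product need no
    negation. *)
Fixpoint qprod (a q : R) (n : nat) : R :=
  match n with
  | O => 1
  | S m => qprod a q m * (1 + a * q ^ m)
  end.

Definition qinf (a q : R) : R := real (Lim_seq (qprod a q)).

Lemma qprod_head (a q : R) (n : nat) : qprod a q (S n) = (1 + a) * qprod (a * q) q n.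
Proof.
  induction n as [|n IH]; [simpl; ring|].
  change (qprod a q (S (S n))) with (qprod a q (S n) * (1 + a * q ^ S n)).
  rewrite IH. simpl. ring.
Qed.

Lemma qprod_add (a q : R) (m n : nat) :
  qprod a q (m + n) = qprod a q m * qprod (a * q ^ m) q n.
Proof.
  induction n as [|n IH].
  - rewrite Nat.add_0_r. simpl. ring.
  - rewrite Nat.add_succ_r. simpl. rewrite IH, pow_add. ring.
Qed.

Lemma qprod_opp (a q : R) (n : nat) :
  qprod a q n * qprod (- a) q n = qprod (- a ^ 2) (q ^ 2) n.
Proof.
  induction n as [|n IH]; [simpl; ring|].
  cbn [qprod]. rewrite <- IH, <- pow_mult, (Nat.mul_comm 2 n), pow_mult. ring.
Qed.

Lemma qprod_double (a q : R) (n : nat) :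
  qprod a q (2 * n) = qprod a (q ^ 2) n * qprod (a * q) (q ^ 2) n.
Proof.
  induction n as [|n IH]; [simpl; ring|].
  replace (2 * S n)%nat with (S (S (2 * n))) by lia.
  cbn [qprod]. rewrite IH. cbn [pow]. rewrite pow_mult. simpl. ring.
Qed.

Lemma qprod_factor_pos (a q : R) (n : nat) : -1 < a -> 0 <= q < 1 -> 0 < 1 + a * q ^ n.
Proof.
  intros Ha Hq. assert (0 <= q ^ n <= 1).
  { split; [apply pow_le; lra|]. rewrite <- (pow1 n). apply pow_incr; lra. }
  destruct (Rle_or_lt 0 a); nra.
Qed.

Lemma qprod_pos (a q : R) (n : nat) : -1 < a -> 0 <= q < 1 -> 0 < qprod a q n.
Proof.
  intros Ha Hq. induction n as [|n IH]; simpl; [lra|].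
  apply Rmult_lt_0_compat; [assumption | now apply qprod_factor_pos].
Qed.

Lemma qprod_le_exp (a q : R) (n : nat) :
  0 <= a -> 0 <= q < 1 -> qprod a q n <= exp (a / (1 - q)).
Proof.
  intros Ha Hq.
  (* The induction uses 1 + x <= exp x and needs the exact partial geometric sum in the exponent. *)
  assert (H : qprod a q n <= exp (a * (1 - q ^ n) / (1 - q))).
  { induction n as [|n IH].
    - simpl. replace (a * (1 - 1) / (1 - q)) with 0 by (field; lra). rewrite exp_0. lra.
    - cbn [qprod].
      replace (a * (1 - q ^ S n) / (1 - q)) with (a * (1 - q ^ n) / (1 - q) + a * q ^ n)
        by (simpl; field; lra).
      rewrite exp_plus. apply Rmult_le_compat; try assumption.
      + apply Rlt_le, qprod_pos; lra.
      + apply Rlt_le, qprod_factor_pos; lra.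
      + apply exp_ineq1_le. }
  eapply Rle_trans; [exact H|].
  assert (Hm : a * (1 - q ^ n) / (1 - q) <= a / (1 - q)).
  { apply Rmult_le_compat_r; [apply Rlt_le, Rinv_0_lt_compat; lra|].
    pose proof (pow_le q n (proj1 Hq)). nra. }
  destruct Hm as [Hm| ->]; [apply Rlt_le, exp_increasing, Hm | lra].
Qed.

(* [1 / (1 - b x) <= 1 + b / (1 - b) x] reduces the lower bound to [qprod_le_exp]. *)
Lemma qprod_neg_lower (a q : R) (n : nat) :
  -1 < a <= 0 -> 0 <= q < 1 -> exp (- (- a / (1 + a) / (1 - q))) <= qprod a q n.
Proof.
  intros Ha Hq. set (c := - a / (1 + a)).
  assert (Hc : 0 <= c) by (apply Rdiv_le_0_compat; lra).
  assert (H : 1 <= qprod a q n * qprod c q n).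
  { induction n as [|n IH]; simpl; [lra|].
    assert (Hx : 0 <= q ^ n <= 1).
    { split; [apply pow_le; lra|]. rewrite <- (pow1 n). apply pow_incr; lra. }
    assert (1 <= (1 + a * q ^ n) * (1 + c * q ^ n)).
    { apply Rmult_le_reg_l with (1 + a); [lra|].
      replace ((1 + a) * ((1 + a * q ^ n) * (1 + c * q ^ n)))
        with ((1 + a * q ^ n) * (1 + a - a * q ^ n)) by (unfold c; field; lra).
      assert (0 <= a ^ 2 * (q ^ n * (1 - q ^ n))) by (apply Rmult_le_pos; nra). nra. }
    nra. }
  pose proof (qprod_le_exp c q n Hc Hq). pose proof (qprod_pos a q n (proj1 Ha) Hq).
  rewrite exp_Ropp. pose proof (exp_pos (c / (1 - q))).
  apply Rmult_le_reg_l with (exp (c / (1 - q))); [assumption|].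
  rewrite Rinv_r by lra. nra.
Qed.

(** The partial products are monotone, upwards or downwards with the sign of a, and the exponential
    bounds keep the limit finite and nonzero. Positivity is what later permits division by infinite
    products. *)
Lemma qinf_spec (a q : R) :
  -1 < a -> 0 <= q < 1 -> is_lim_seq (qprod a q) (qinf a q) /\ 0 < qinf a q.
Proof.
  intros Ha Hq.
  assert (Hpow : forall n, 0 <= q ^ n) by (intro; apply pow_le; lra).
  destruct (Rle_or_lt 0 a) as [H0|H0].
  - assert (Hmon : forall n, qprod a q n <= qprod a q (S n)).
    { intro n. simpl. pose proof (qprod_pos a q n Ha Hq). specialize (Hpow n).
      assert (0 <= a * q ^ n) by nra. nra. }
    assert (HL : is_lim_seq (qprod a q) (qinf a q)).
    { apply Lim_seq_correct', (ex_finite_lim_seq_incr _ (exp (a / (1 - q)))); [assumption|].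
      intro. now apply qprod_le_exp. }
    split; [assumption|].
    pose proof (is_lim_seq_incr_compare _ _ HL Hmon 0). simpl in *. lra.
  - assert (HL : is_lim_seq (qprod a q) (qinf a q)).
    { apply Lim_seq_correct', (ex_finite_lim_seq_decr _ 0).
      - intro n. simpl. pose proof (qprod_pos a q n Ha Hq). specialize (Hpow n).
        assert (a * q ^ n <= 0) by nra. nra.
      - intro n. now apply Rlt_le, qprod_pos. }
    split; [assumption|].
    apply Rlt_le_trans with (exp (- (- a / (1 + a) / (1 - q)))); [apply exp_pos|].
    apply (is_lim_seq_le (fun _ => exp (- (- a / (1 + a) / (1 - q)))) (qprod a q)
             (exp (- (- a / (1 + a) / (1 - q)))) (qinf a q)); auto using is_lim_seq_const.
    intro n. apply qprod_neg_lower; lra.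
Qed.

Lemma is_lim_seq_eq (u : nat -> R) (l l' : R) : is_lim_seq u l -> is_lim_seq u l' -> l = l'.
Proof.
  intros H H'. apply is_lim_seq_unique in H. apply is_lim_seq_unique in H'.
  rewrite H in H'. now injection H'.
Qed.

Lemma qinf_opp (a q : R) :
  -1 < a < 1 -> 0 <= q < 1 -> qinf a q * qinf (- a) q = qinf (- a ^ 2) (q ^ 2).
Proof.
  intros Ha Hq.
  apply (is_lim_seq_eq (qprod (- a ^ 2) (q ^ 2))).
  - apply (is_lim_seq_ext (fun n => qprod a q n * qprod (- a) q n)).
    { intro; apply qprod_opp. }
    apply is_lim_seq_mult'; apply qinf_spec; lra.
  - apply qinf_spec; nra.
Qed.

Lemma qinf_double (a q : R) :
  -1 < a -> -1 < a * q -> 0 <= q < 1 ->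
  qinf a q = qinf a (q ^ 2) * qinf (a * q) (q ^ 2).
Proof.
  intros Ha Haq Hq.
  apply (is_lim_seq_eq (fun n => qprod a q (2 * n))).
  - apply (is_lim_seq_subseq (qprod a q) _ (fun n => 2 * n)%nat).
    + apply eventually_subseq. intro; lia.
    + now apply qinf_spec.
  - apply (is_lim_seq_ext (fun n => qprod a (q ^ 2) n * qprod (a * q) (q ^ 2) n)).
    { intro; symmetry; apply qprod_double. }
    apply is_lim_seq_mult'; apply qinf_spec; nra.
Qed.

Lemma qinf_head (a q : R) :
  -1 < a -> -1 < a * q -> 0 <= q < 1 -> qinf a q = (1 + a) * qinf (a * q) q.
Proof.
  intros Ha Haq Hq.
  apply (is_lim_seq_eq (fun n => qprod a q (S n))).
  - apply -> is_lim_seq_incr_1. now apply qinf_spec.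
  - apply (is_lim_seq_ext (fun n => (1 + a) * qprod (a * q) q n)).
    { intro; symmetry; apply qprod_head. }
    apply (is_lim_seq_scal_l _ (1 + a) (qinf (a * q) q)). now apply qinf_spec.
Qed.

(** [prod_f_R0 _ N] has N + 1 factors, hence the shift of the sequence by one. *)
Lemma eta_qinf (q : R) : eta q = qinf (- q) q.
Proof.
  unfold eta, qinf. rewrite <- (Lim_seq_incr_1 (qprod (- q) q)). f_equal.
  apply Lim_seq_ext. intro N. induction N as [|N IH].
  - simpl. ring.
  - change (prod_f_R0 (fun n => 1 - q ^ S n) (S N))
      with (prod_f_R0 (fun n => 1 - q ^ S n) N * (1 - q ^ S (S N))).
    change (qprod (- q) q (S (S N))) with (qprod (- q) q (S N) * (1 + - q * q ^ S N)).
    rewrite IH. simpl. ring.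
Qed.

(** Gaussian binomials by their Pascal rule, without division, so that the finite q-binomial theorem
    becomes an induction. The quotient form is recovered in [gauss_binom_qprod]. *)
Fixpoint gauss_binom (Q : R) (m j : nat) : R :=
  match j, m with
  | O, _ => 1
  | S _, O => 0
  | S j', S m' => gauss_binom Q m' (S j') + Q ^ (m' - j') * gauss_binom Q m' j'
  end.

Lemma gauss_binom_0 (Q : R) (m : nat) : gauss_binom Q m 0 = 1.
Proof. now destruct m. Qed.

Lemma gauss_binom_gt (Q : R) (m j : nat) : (m < j)%nat -> gauss_binom Q m j = 0.
Proof.
  revert j. induction m as [|m IH]; intros [|j] H; try lia; [reflexivity|].
  simpl. rewrite !IH by lia. ring.
Qed.

Lemma gauss_binom_qprod (Q : R) (a b : nat) :
  gauss_binom Q (a + b) a * (qprod (- Q) Q a * qprod (- Q) Q b) = qprod (- Q) Q (a + b).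
Proof.
  enough (H : forall m a b, (a + b)%nat = m ->
    gauss_binom Q m a * (qprod (- Q) Q a * qprod (- Q) Q b) = qprod (- Q) Q m)
    by now apply H.
  clear. induction m as [|m IH]; intros [|a] b H; try lia.
  - replace b with 0%nat by lia. simpl. ring.
  - simpl in H. subst b. rewrite gauss_binom_0. simpl (qprod _ _ 0). ring.
  - cbn [gauss_binom]. replace (m - a)%nat with b by lia.
    destruct b as [|b].
    + rewrite gauss_binom_gt by lia. replace a with m by lia.
      pose proof (IH m 0%nat ltac:(lia)) as H0. simpl in *. rewrite <- H0 at 2. ring.
    + pose proof (IH (S a) b ltac:(lia)) as H1. pose proof (IH a (S b) ltac:(lia)) as H2.
      (* The last factor splits as 1 - Q^(a+b+2) = (1 - Q^(b+1)) + Q^(b+1) (1 - Q^(a+1)), one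
         summand for each branch of the Pascal rule. *)
      replace (qprod (- Q) Q (S m))
        with (qprod (- Q) Q m * (1 - Q ^ S b) + Q ^ S b * (qprod (- Q) Q m * (1 - Q ^ S a))).
      2:{ replace m with (a + S b)%nat by lia. simpl. rewrite pow_add. simpl. ring. }
      rewrite <- H1 at 1. rewrite <- H2. simpl. ring.
Qed.

(** * Finite sums and the finite triple product *)

Lemma sum_n_shift (f : nat -> R) (N : nat) :
  sum_n f (S N) = f 0%nat + sum_n (fun n => f (S n)) N.
Proof.
  induction N as [|N IH].
  - rewrite sum_Sn, !sum_O. reflexivity.
  - rewrite sum_Sn, IH, sum_Sn. unfold plus; simpl. eqR. ring.
Qed.

Lemma sum_n_rev (f : nat -> R) (N : nat) : sum_n (fun n => f (N - n)%nat) N = sum_n f N.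
Proof.
  induction N as [|N IH]; [now rewrite !sum_O|].
  rewrite sum_n_shift, (sum_Sn f), <- IH. unfold plus; simpl. eqR. ring.
Qed.

(** Both halves contain the central term, hence the subtraction; it survives as the - 1 in
    [jacobi_triple_product]. *)
Lemma sum_n_center (f : nat -> R) (N M : nat) :
  sum_n f (N + M) =
  sum_n (fun n => f (N + n)%nat) M + sum_n (fun n => f (N - n)%nat) N - f N.
Proof.
  induction M as [|M IH].
  - rewrite sum_O, sum_n_rev, Nat.add_0_r. eqR. ring.
  - rewrite Nat.add_succ_r, !sum_Sn, IH, Nat.add_succ_r. unfold plus; simpl. eqR. ring.
Qed.

Lemma sum_n_Rmult_l (c : R) (f : nat -> R) (N : nat) :
  sum_n (fun n => c * f n) N = c * sum_n f N.
Proof. apply (sum_n_mult_l (K := R_Ring)). Qed.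

(** Multiplying by the last factor 1 + y q^(2M+1) acts on the coefficients as the Pascal rule; the
    powers of q agree since (j+1)^2 = j^2 + 2j + 1. *)
Lemma q_binomial (q y : R) (M : nat) :
  qprod (y * q) (q ^ 2) M =
  sum_n (fun j => gauss_binom (q ^ 2) M j * (q ^ (j * j) * y ^ j)) M.
Proof.
  induction M as [|M IH].
  - rewrite sum_O. simpl. eqR. ring.
  - rewrite sum_n_shift. cbn [qprod]. rewrite IH.
    rewrite (sum_n_ext_loc (fun j => gauss_binom (q ^ 2) (S M) (S j) * (q ^ (S j * S j) * y ^ S j))
      (fun j => gauss_binom (q ^ 2) M (S j) * (q ^ (S j * S j) * y ^ S j)
      + y * q * (q ^ 2) ^ M * (gauss_binom (q ^ 2) M j * (q ^ (j * j) * y ^ j)))).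
    2:{ intros j Hj. cbn [gauss_binom].
        rewrite Rmult_plus_distr_r. apply f_equal.
        replace M with ((M - j) + j)%nat at 3 by lia.
        rewrite (pow_add _ (M - j) j), <- (pow_mult q 2 j).
        replace (S j * S j)%nat with (j * j + (2 * j + 1))%nat by lia.
        rewrite (pow_add q (j * j)), (pow_add q (2 * j)). simpl. ring. }
    rewrite (sum_n_plus (G := R_AbelianMonoid)), sum_n_Rmult_l.
    pose proof (sum_n_shift (fun j => gauss_binom (q ^ 2) M j * (q ^ (j * j) * y ^ j)) M) as E.
    rewrite sum_Sn, gauss_binom_gt in E by lia.
    rewrite gauss_binom_0 in *. unfold plus in *; simpl in *.
    rewrite Rmult_0_l, Rplus_0_r in E.
    rewrite Rmult_plus_distr_l, Rmult_1_r, <- Rplus_assoc, <- E. ring.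
Qed.

(** The factors on the left have the negative odd exponents -(2N-1), ..., -1. Pulling z q^(-(2k-1))
    out of each inverts z, and the first N odd numbers add up to N^2. *)
Lemma qprod_reverse (q z : R) (N : nat) :
  q <> 0 -> z <> 0 ->
  qprod (z / (q ^ 2) ^ N * q) (q ^ 2) N * q ^ (N * N) = z ^ N * qprod (/ z * q) (q ^ 2) N.
Proof.
  intros Hq Hz. induction N as [|N IH].
  - simpl. ring.
  - assert (Hu : (q ^ 2) ^ N <> 0) by now apply pow_nonzero, pow_nonzero.
    rewrite qprod_head. cbn [qprod].
    replace ((q ^ 2) ^ S N) with (q ^ 2 * (q ^ 2) ^ N) by reflexivity.
    replace (S N * S N)%nat with (N * N + 2 * N + 1)%nat by lia.
    rewrite !pow_add, (pow_mult q 2 N), pow_1.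
    set (u := (q ^ 2) ^ N) in *.
    replace (z / (q ^ 2 * u) * q * q ^ 2) with (z / u * q) by (field; now split).
    transitivity ((1 + z / (q ^ 2 * u) * q) * u * q * (qprod (z / u * q) (q ^ 2) N * q ^ (N * N)));
      [ring|].
    rewrite IH. change (z ^ S N) with (z * z ^ N). field. now repeat split.
Qed.

(** The q-binomial theorem with 2N factors, shifted by y = z q^(-2N) so that the exponents lie
    symmetrically about 0. *)
Lemma jacobi_finite (q z : R) (N : nat) :
  q <> 0 -> z <> 0 ->
  qprod (z * q) (q ^ 2) N * qprod (/ z * q) (q ^ 2) N =
  sum_n (fun n => gauss_binom (q ^ 2) (N + N) (N + n) * (q ^ (n * n) * z ^ n)) N +
  sum_n (fun n => gauss_binom (q ^ 2) (N + N) (N - n) * (q ^ (n * n) * (/ z) ^ n)) N -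
  gauss_binom (q ^ 2) (N + N) N.
Proof.
  intros Hq Hz.
  assert (Hp : forall x n, x <> 0 -> x ^ n <> 0) by (intros; now apply pow_nonzero).
  assert (Hq2 : q ^ 2 <> 0) by now apply Hp.
  apply Rmult_eq_reg_l with (z ^ N); [|now apply Hp].
  transitivity (qprod (z / (q ^ 2) ^ N * q) (q ^ 2) (N + N) * q ^ (N * N)).
  { rewrite qprod_add.
    replace (z / (q ^ 2) ^ N * q * (q ^ 2) ^ N) with (z * q) by (field; now apply Hp).
    transitivity (qprod (z * q) (q ^ 2) N * (z ^ N * qprod (/ z * q) (q ^ 2) N)); [ring|].
    rewrite <- qprod_reverse by assumption. ring. }
  rewrite q_binomial, sum_n_center, Rmult_comm.
  rewrite !Rmult_minus_distr_l, !Rmult_plus_distr_l, <- !sum_n_Rmult_l.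
  (* Completes the square to q^((N-j)^2), written as a quotient because exponents are natural
     numbers. *)
  assert (Hc : forall j : nat, q ^ (N * N) * (q ^ (j * j) * (z / (q ^ 2) ^ N) ^ j) =
     q ^ (N * N + j * j) / q ^ (2 * N * j) * z ^ j).
  { intro j. unfold Rdiv. rewrite Rpow_mult_distr, pow_inv, <- !pow_mult, pow_add.
    rewrite Nat.mul_assoc. ring. }
  f_equal; [f_equal|].
  - apply sum_n_ext. intro n. match goal with |- ?a = ?b => change (@eq R a b) end.
    transitivity (gauss_binom (q ^ 2) (N + N) (N + n) *
      (q ^ (N * N) * (q ^ ((N + n) * (N + n)) * (z / (q ^ 2) ^ N) ^ (N + n)))); [ring|].
    rewrite Hc.
    replace (N * N + (N + n) * (N + n))%nat with (2 * N * (N + n) + n * n)%nat by lia.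
    rewrite !pow_add. field. now apply Hp.
  - apply sum_n_ext_loc. intros n Hn. match goal with |- ?a = ?b => change (@eq R a b) end.
    transitivity (gauss_binom (q ^ 2) (N + N) (N - n) *
      (q ^ (N * N) * (q ^ ((N - n) * (N - n)) * (z / (q ^ 2) ^ N) ^ (N - n)))); [ring|].
    rewrite Hc.
    replace (N * N + (N - n) * (N - n))%nat with (2 * N * (N - n) + n * n)%nat by nia.
    replace (z ^ N) with (z ^ (N - n) * z ^ n) by (rewrite <- pow_add; f_equal; lia).
    rewrite !pow_add, pow_inv. field. split; now apply Hp.
  - transitivity (gauss_binom (q ^ 2) (N + N) N *
      (q ^ (N * N) * (q ^ (N * N) * (z / (q ^ 2) ^ N) ^ N))); [ring|].
    rewrite Hc. replace (2 * N * N)%nat with (N * N + N * N)%nat by lia.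
    field. now apply Hp.
Qed.

(** Dominated convergence for series: up to a fixed K termwise convergence is enough, and beyond K
    the sum is bounded by a tail of the absolutely convergent series, uniformly in N. *)
Lemma tannery (c : nat -> nat -> R) (a : nat -> R) (C l : R) :
  (forall N n, (n <= N)%nat -> Rabs (c N n) <= C) ->
  (forall n, is_lim_seq (fun N => c N n) l) ->
  ex_series (fun n => Rabs (a n)) ->
  is_lim_seq (fun N => sum_n (fun n => c N n * a n) N) (l * Series a).
Proof.
  intros HC Hl Ha.
  assert (Hser : is_lim_seq (fun N => l * sum_n a N) (l * Series a)).
  { apply (is_lim_seq_scal_l _ l (Series a)), Series_correct, ex_series_Rabs, Ha. }
  set (b := fun n => Rabs (a n)) in *.
  assert (Hb0 : forall n, 0 <= b n) by (intro; apply Rabs_pos).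
  set (D := C + Rabs l).
  assert (HD : 0 <= D).
  { unfold D. pose proof (Rabs_pos l). pose proof (HC 0 0 (le_n _))%nat.
    pose proof (Rabs_pos (c 0 0)%nat). lra. }
  set (e := fun N n => Rabs (c N n - l) * b n).
  assert (He : forall N n, (n <= N)%nat -> e N n <= D * b n).
  { intros N n Hn. apply Rmult_le_compat_r; [apply Hb0|].
    unfold D, Rminus. eapply Rle_trans; [apply Rabs_triang|].
    rewrite Rabs_Ropp. specialize (HC N n Hn). lra. }
  assert (Hsplit : forall N K M, (K <= M <= N)%nat ->
     sum_n (e N) M <= sum_n (e N) K + D * (sum_n b M - sum_n b K)).
  { intros N K M [HKM HMN]. induction HKM as [|M HKM IH]; [lra|].
    rewrite !sum_Sn. unfold plus; simpl. specialize (IH ltac:(lia)).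
    pose proof (He N (S M) HMN). lra. }
  assert (Hfin : forall K, is_lim_seq (fun N => sum_n (e N) K) 0).
  { intro K. induction K as [|K IH].
    - apply (is_lim_seq_ext (fun N => e N 0%nat)); [intro; now rewrite sum_O|].
      unfold e. replace 0 with (Rabs (l - l) * b 0%nat) by (rewrite Rminus_diag, Rabs_R0; ring).
      apply is_lim_seq_mult'; [|apply is_lim_seq_const].
      apply (is_lim_seq_abs _ (l - l)), is_lim_seq_minus'; [apply Hl | apply is_lim_seq_const].
    - apply (is_lim_seq_ext (fun N => sum_n (e N) K + e N (S K))); [intro; now rewrite sum_Sn|].
      replace 0 with (0 + Rabs (l - l) * b (S K)) by (rewrite Rminus_diag, Rabs_R0; ring).
      apply is_lim_seq_plus'; [exact IH|].
      apply is_lim_seq_mult'; [|apply is_lim_seq_const].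
      apply (is_lim_seq_abs _ (l - l)), is_lim_seq_minus'; [apply Hl | apply is_lim_seq_const]. }
  enough (H0 : is_lim_seq (fun N => sum_n (fun n => c N n * a n) N - l * sum_n a N) 0).
  { apply (is_lim_seq_ext (fun N => (sum_n (fun n => c N n * a n) N - l * sum_n a N) + l * sum_n a N)).
    { intro; ring. }
    replace (l * Series a) with (0 + l * Series a) by ring.
    now apply is_lim_seq_plus'. }
  apply is_lim_seq_spec. intro eps.
  set (S := Series b). assert (HS : is_lim_seq (sum_n b) S) by now apply Series_correct.
  assert (HSn : forall n, sum_n b n <= S) by (intro; now apply sum_n_le_series).
  (* D + 1 rather than D, which may be 0. *)
  assert (Heps : 0 < eps / 2 / (D + 1)) by (destruct eps; simpl; apply Rdiv_lt_0_compat; lra).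
  apply is_lim_seq_spec in HS. destruct (HS (mkposreal _ Heps)) as [K HK].
  specialize (HK K (le_n _)). simpl in HK.
  specialize (Hfin K). apply is_lim_seq_spec in Hfin.
  destruct (Hfin (pos_div_2 eps)) as [N0 HN0]. simpl in HN0.
  exists (max N0 K). intros N HN.
  specialize (HN0 N ltac:(lia)). specialize (Hsplit N K N ltac:(lia)).
  assert (Habs : Rabs (sum_n (fun n => c N n * a n) N - l * sum_n a N) <= sum_n (e N) N).
  { rewrite <- sum_n_Rmult_l, <- sum_n_Rminus.
    eapply Rle_trans; [apply (norm_sum_n_m (K := R_AbsRing) (V := R_NormedModule))|].
    apply Req_le, sum_n_m_ext. intro n. unfold norm; simpl; unfold abs; simpl.
    unfold e, b. rewrite <- Rabs_mult. f_equal. ring. }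
  rewrite Rminus_0_r in *.
  apply Rabs_def2 in HN0. apply Rabs_def2 in HK.
  assert (D * (sum_n b N - sum_n b K) <= D * (eps / 2 / (D + 1))).
  { apply Rmult_le_compat_l; [assumption|]. specialize (HSn N). lra. }
  assert (D * (eps / 2 / (D + 1)) <= eps / 2).
  { replace (eps / 2) with ((D + 1) * (eps / 2 / (D + 1))) at 2 by (field; lra).
    apply Rmult_le_compat_r; lra. }
  lra.
Qed.

(** The terms n >= 0 of the bilateral theta series. The full series is
    [theta_half q z + theta_half q (/ z) - 1], as n = 0 occurs in both halves. *)
Definition theta_half (q z : R) : R := Series (fun n => q ^ (n * n) * z ^ n).

Lemma ex_series_theta_half (q z : R) :
  0 < q < 1 -> z <> 0 -> ex_series (fun n => Rabs (q ^ (n * n) * z ^ n)).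
Proof.
  intros Hq Hz. apply (ex_series_DAlembert _ 0); [lra | |].
  - intro n. apply Rmult_integral_contrapositive_currified; apply pow_nonzero; lra.
  - apply (is_lim_seq_ext (fun n => Rabs (q * z) * (q ^ 2) ^ n)).
    { intro n. rewrite <- (Rabs_pos_eq ((q ^ 2) ^ n)) by (apply pow_le, pow_le; lra).
      rewrite <- Rabs_mult. f_equal. replace (S n * S n)%nat with (n * n + 2 * n + 1)%nat by lia.
      rewrite !pow_add, (pow_mult q 2 n). simpl. field.
      split; apply pow_nonzero; lra. }
    replace (Finite 0) with (Rbar_mult (Rabs (q * z)) 0) by (simpl; f_equal; ring).
    apply is_lim_seq_scal_l, is_lim_seq_geom. rewrite Rabs_pos_eq; nra.
Qed.

(** In quotient form, the numerator and both factors of the denominator tend to the same infinite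
    product, so the limit is the same for every n, as [tannery] requires. *)
Lemma gauss_binom_lim (Q : R) (n : nat) :
  0 <= Q < 1 -> is_lim_seq (fun N => gauss_binom Q (N + N) (N + n)) (/ qinf (- Q) Q).
Proof.
  intro HQ. destruct (qinf_spec (- Q) Q ltac:(lra) HQ) as [HL HA].
  (* N - n is a true difference only for N >= n. *)
  apply (is_lim_seq_ext_loc (fun N => qprod (- Q) Q (N + N) / (qprod (- Q) Q (N + n) * qprod (- Q) Q (N - n)))).
  { exists n. intros N HN.
    pose proof (gauss_binom_qprod Q (N + n) (N - n)) as H.
    replace (N + n + (N - n))%nat with (N + N)%nat in H by lia. rewrite <- H.
    field. split; apply Rgt_not_eq, qprod_pos; lra. }
  replace (/ qinf (- Q) Q) with (qinf (- Q) Q / (qinf (- Q) Q * qinf (- Q) Q)) by (field; lra).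
  apply is_lim_seq_div'; [| apply is_lim_seq_mult' | nra];
    apply (is_lim_seq_subseq (qprod (- Q) Q)); try assumption;
    intros P [N0 HP]; [exists N0 | exists N0 | exists (N0 + n)%nat]; intros N HN; apply HP; lia.
Qed.

(** The partial products decrease from 1 to their limit: the numerator is at most 1 and each factor
    of the denominator at least [qinf (- Q) Q]. *)
Lemma gauss_binom_bound (Q : R) (N n : nat) :
  0 <= Q < 1 -> (n <= N)%nat -> Rabs (gauss_binom Q (N + N) (N + n)) <= / qinf (- Q) Q ^ 2.
Proof.
  intros HQ Hn. destruct (qinf_spec (- Q) Q ltac:(lra) HQ) as [HL HA].
  assert (Hdec : forall n, qprod (- Q) Q (S n) <= qprod (- Q) Q n).
  { intro k. simpl. pose proof (qprod_pos (- Q) Q k ltac:(lra) HQ).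
    pose proof (pow_le Q k (proj1 HQ)). assert (0 <= Q * Q ^ k) by nra. nra. }
  assert (Hge : forall n, qinf (- Q) Q <= qprod (- Q) Q n).
  { apply (is_lim_seq_decr_compare _ _ HL Hdec). }
  assert (Hle : forall n, qprod (- Q) Q n <= 1).
  { induction n0 as [|k IH]; [simpl; lra|]. specialize (Hdec k). lra. }
  pose proof (gauss_binom_qprod Q (N + n) (N - n)) as H.
  replace (N + n + (N - n))%nat with (N + N)%nat in H by lia.
  pose proof (Hge (N + n)%nat) as H1. pose proof (Hge (N - n)%nat) as H2.
  set (x := qprod (- Q) Q (N + n)) in *. set (y := qprod (- Q) Q (N - n)) in *.
  assert (E : gauss_binom Q (N + N) (N + n) = qprod (- Q) Q (N + N) / (x * y))
    by (rewrite <- H; field; lra).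
  assert (0 < qinf (- Q) Q ^ 2 <= x * y) by nra.
  assert (0 < / (x * y) <= / qinf (- Q) Q ^ 2).
  { split; [apply Rinv_0_lt_compat; lra | apply Rinv_le_contravar; lra]. }
  pose proof (qprod_pos (- Q) Q (N + N) ltac:(lra) HQ). specialize (Hle (N + N)%nat).
  rewrite E, Rabs_pos_eq; unfold Rdiv; nra.
Qed.

Lemma gauss_binom_sym (Q : R) (N n : nat) :
  0 <= Q < 1 -> (n <= N)%nat -> gauss_binom Q (N + N) (N - n) = gauss_binom Q (N + N) (N + n).
Proof.
  intros HQ Hn.
  pose proof (gauss_binom_qprod Q (N + n) (N - n)) as H.
  pose proof (gauss_binom_qprod Q (N - n) (N + n)) as H'.
  replace (N + n + (N - n))%nat with (N + N)%nat in H by lia.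
  replace (N - n + (N + n))%nat with (N + N)%nat in H' by lia.
  pose proof (qprod_pos (- Q) Q (N + n) ltac:(lra) HQ).
  pose proof (qprod_pos (- Q) Q (N - n) ltac:(lra) HQ).
  apply Rmult_eq_reg_r with (qprod (- Q) Q (N + n) * qprod (- Q) Q (N - n)); [|nra].
  rewrite H, <- H'. ring.
Qed.

(** The limit of [jacobi_finite]: every Gaussian coefficient tends to 1 / A, and [tannery] passes to
    the limit in both half-sums. *)
Lemma jacobi_triple_product (q z : R) :
  0 < q < 1 -> z <> 0 -> -1 < z * q -> -1 < / z * q ->
  theta_half q z + theta_half q (/ z) - 1 =
  qinf (- q ^ 2) (q ^ 2) * qinf (z * q) (q ^ 2) * qinf (/ z * q) (q ^ 2).
Proof.
  intros Hq Hz H1 H2.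
  assert (HQ : 0 <= q ^ 2 < 1) by nra.
  destruct (qinf_spec (- q ^ 2) (q ^ 2) ltac:(lra) HQ) as [_ HA].
  set (A := qinf (- q ^ 2) (q ^ 2)) in *.
  enough (E : qinf (z * q) (q ^ 2) * qinf (/ z * q) (q ^ 2) =
    / A * theta_half q z + / A * theta_half q (/ z) - / A).
  { rewrite Rmult_assoc, E. field. lra. }
  apply (is_lim_seq_eq (fun N => qprod (z * q) (q ^ 2) N * qprod (/ z * q) (q ^ 2) N)).
  { apply is_lim_seq_mult'; apply qinf_spec; assumption. }
  eapply is_lim_seq_ext.
  { intro N. symmetry. apply jacobi_finite; lra. }
  assert (HT : forall w, w <> 0 -> is_lim_seq
    (fun N => sum_n (fun n => gauss_binom (q ^ 2) (N + N) (N + n) * (q ^ (n * n) * w ^ n)) N)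
    (/ A * theta_half q w)).
  { intros w Hw. apply (tannery _ (fun n => q ^ (n * n) * w ^ n) (/ A ^ 2)).
    - intros. now apply gauss_binom_bound.
    - intro. now apply gauss_binom_lim.
    - now apply ex_series_theta_half. }
  apply is_lim_seq_minus'; [apply is_lim_seq_plus'|].
  - now apply HT.
  - eapply is_lim_seq_ext; [|apply (HT (/ z)); now apply Rinv_neq_0_compat].
    intro N. apply sum_n_ext_loc. intros n Hn. cbv beta. now rewrite gauss_binom_sym.
  - apply (is_lim_seq_ext (fun N => gauss_binom (q ^ 2) (N + N) (N + 0))).
    { intro; now rewrite Nat.add_0_r. }
    now apply gauss_binom_lim.
Qed.

(** * Theta functions and the singular modulus *)

(* In terms of the classical theta functions, [theta2_red q] is
   [theta_2(q) / q^(1/4)]. *)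
Definition theta2_red (q : R) : R := 2 * theta_half q q.
Definition theta3 (q : R) : R := 2 * theta_half q 1 - 1.
Definition theta4 (q : R) : R := 2 * theta_half q (-1) - 1.

Lemma is_series_theta_half (q z : R) :
  0 < q < 1 -> z <> 0 -> is_series (fun n => q ^ (n * n) * z ^ n) (theta_half q z).
Proof. intros Hq Hz. apply Series_correct, ex_series_Rabs. now apply ex_series_theta_half. Qed.

(** Since (n+1)^2 - (n+1) = n^2 + n, the two halves of the series of theta_2 agree. *)
Lemma theta_half_inv (q : R) : 0 < q < 1 -> theta_half q (/ q) = 1 + theta_half q q.
Proof.
  intro Hq. unfold theta_half at 1. rewrite Series_incr_1.
  2:{ eexists. apply is_series_theta_half; [assumption | apply Rinv_neq_0_compat; lra]. }
  simpl (_ ^ 0). f_equal; [simpl; ring|].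
  apply Series_ext. intro n.
  replace (S n * S n)%nat with (n * n + n + S n)%nat by lia.
  rewrite !pow_add, pow_inv. field. apply pow_nonzero; lra.
Qed.

Lemma theta_half_bounds (q z : R) :
  0 < q < 1 -> 0 < z <= 1 -> 1 <= theta_half q z <= / (1 - q).
Proof.
  intros Hq Hz. assert (Hs := is_series_theta_half q z Hq ltac:(lra)).
  assert (Hpos : forall n, 0 <= q ^ (n * n) * z ^ n)
    by (intro; apply Rmult_le_pos; apply pow_le; lra).
  split.
  - pose proof (sum_n_le_series _ _ 0 Hpos Hs) as H. rewrite sum_O in H. simpl in H. lra.
  - apply (is_series_le _ (fun n => q ^ n) _ _) with (2 := Hs).
    + intro n. assert (Hn : q ^ (n * n) <= q ^ n).
      { destruct n as [|n]; [simpl; lra|].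
        replace (S n * S n)%nat with (S n + n * S n)%nat by lia. rewrite pow_add.
        pose proof (pow_le q (S n) ltac:(lra)).
        assert (q ^ (n * S n) <= 1) by (rewrite <- (pow1 (n * S n)); apply pow_incr; lra).
        nra. }
      assert (0 <= z ^ n <= 1).
      { split; [apply pow_le; lra|]. rewrite <- (pow1 n). apply pow_incr; lra. }
      pose proof (pow_le q (n * n) ltac:(lra)). nra.
    + apply is_series_geom. rewrite Rabs_pos_eq; lra.
Qed.

(** * Even and odd parts of the theta series *)

Lemma is_pseries_Rmult (a : nat -> R) (x l : R) :
  is_pseries a x l <-> is_series (fun n => a n * x ^ n) l.
Proof.
  assert (E : forall n, scal (pow_n x n) (a n) = a n * x ^ n).
  { intro n. rewrite pow_n_pow. apply Rmult_comm. }
  split; apply is_series_ext; intro n; [|symmetry]; apply E.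
Qed.

(** Splits by the parity of n; the odd squares are 4 (m^2 + m) + 1. The condition on x treats
    [theta3] and [theta4] together. *)
Lemma theta_half_even_odd (q x : R) :
  0 < q < 1 -> x ^ 2 = 1 ->
  theta_half q x = theta_half (q ^ 4) 1 + x * (q * theta_half (q ^ 4) (q ^ 4)).
Proof.
  intros Hq Hx. assert (Hq4 : 0 < q ^ 4 < 1).
  { assert (0 < q ^ 2 < 1) by nra. replace (q ^ 4) with (q ^ 2 * q ^ 2) by ring. nra. }
  unfold theta_half at 1. apply is_series_unique, is_pseries_Rmult, is_pseries_odd_even;
    apply is_pseries_Rmult; rewrite Hx.
  - apply (is_series_ext (fun n => (q ^ 4) ^ (n * n) * 1 ^ n)).
    + intro n. rewrite <- pow_mult. do 2 f_equal. lia.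
    + apply is_series_theta_half; lra.
  - apply (is_series_ext (fun n => q * ((q ^ 4) ^ (n * n) * (q ^ 4) ^ n))).
    + intro n. rewrite <- !pow_mult, <- pow_add, pow1, Rmult_1_r.
      replace ((2 * n + 1) * (2 * n + 1))%nat with (S (4 * (n * n) + 4 * n))%nat by lia.
      reflexivity.
    + apply (is_series_scal (V := R_NormedModule) q), is_series_theta_half; lra.
Qed.

Lemma theta34_plus (q : R) : 0 < q < 1 -> theta3 q + theta4 q = 2 * theta3 (q ^ 4).
Proof.
  intro Hq. unfold theta3, theta4.
  rewrite (theta_half_even_odd q 1), (theta_half_even_odd q (-1)) by (assumption || ring). ring.
Qed.

Lemma theta34_minus (q : R) : 0 < q < 1 -> theta3 q - theta4 q = 2 * q * theta2_red (q ^ 4).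
Proof.
  intro Hq. unfold theta3, theta4, theta2_red.
  rewrite (theta_half_even_odd q 1), (theta_half_even_odd q (-1)) by (assumption || ring). ring.
Qed.

(** Jacobi's four products over n >= 1: A of 1 - q^(2n), B of 1 + q^(2n), C of 1 + q^(2n-1), D of 1
    - q^(2n-1). *)
Definition prodA (q : R) : R := qinf (- q ^ 2) (q ^ 2).
Definition prodB (q : R) : R := qinf (q ^ 2) (q ^ 2).
Definition prodC (q : R) : R := qinf q (q ^ 2).
Definition prodD (q : R) : R := qinf (- q) (q ^ 2).

Lemma prod_pos (q : R) :
  0 < q < 1 -> 0 < prodA q /\ 0 < prodB q /\ 0 < prodC q /\ 0 < prodD q.
Proof. intro Hq. assert (0 < q ^ 2 < 1) by nra. repeat split; apply qinf_spec; lra. Qed.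

Lemma prodAB (q : R) : 0 < q < 1 -> prodA q * prodB q = prodA (q ^ 2).
Proof. intro Hq. unfold prodA, prodB. rewrite Rmult_comm. assert (0 < q ^ 2 < 1) by nra. apply qinf_opp; lra. Qed.

Lemma prodCD (q : R) : 0 < q < 1 -> prodC q * prodD q = prodD (q ^ 2).
Proof. intro Hq. unfold prodC, prodD. assert (0 < q ^ 2 < 1) by nra. apply qinf_opp; lra. Qed.

Lemma prodA_split (q : R) : 0 < q < 1 -> prodA q = prodD (q ^ 2) * prodA (q ^ 2).
Proof.
  intro Hq. unfold prodA, prodD. assert (0 < q ^ 2 < 1) by nra. rewrite qinf_double by nra.
  do 2 f_equal. ring.
Qed.

Lemma prodB_split (q : R) : 0 < q < 1 -> prodB q = prodC (q ^ 2) * prodB (q ^ 2).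
Proof.
  intro Hq. unfold prodB, prodC. assert (0 < q ^ 2 < 1) by nra. rewrite qinf_double by nra.
  do 2 f_equal. ring.
Qed.

(** Euler's identity. AB and CD are products in q^2, and A(q^2) D(q^2) reassembles A(q), which can
    be cancelled. *)
Lemma prodBCD (q : R) : 0 < q < 1 -> prodB q * prodC q * prodD q = 1.
Proof.
  intro Hq. pose proof (prod_pos q Hq) as [HA _].
  apply Rmult_eq_reg_l with (prodA q); [|lra].
  replace (prodA q * (prodB q * prodC q * prodD q))
    with ((prodC q * prodD q) * (prodA q * prodB q)) by ring.
  rewrite prodAB, prodCD, <- prodA_split by assumption. ring.
Qed.

Lemma theta2_red_prod (q : R) : 0 < q < 1 -> theta2_red q = 2 * prodA q * prodB q ^ 2.
Proof.
  intro Hq.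
  assert (Hq1 : / q * q = 1) by (field; lra).
  pose proof (jacobi_triple_product q q Hq ltac:(lra) ltac:(nra) ltac:(lra)) as H.
  rewrite theta_half_inv, Hq1 in H by assumption.
  (* The leading factor 1 + 1 is split off; what remains is a second copy of B. *)
  rewrite (qinf_head 1) in H by nra.
  replace (1 * q ^ 2) with (q ^ 2) in H by ring. replace (q * q) with (q ^ 2) in H by ring.
  unfold theta2_red, prodA, prodB. lra.
Qed.

Lemma theta3_prod (q : R) : 0 < q < 1 -> theta3 q = prodA q * prodC q ^ 2.
Proof.
  intro Hq.
  pose proof (jacobi_triple_product q 1 Hq ltac:(lra) ltac:(lra) ltac:(lra)) as H.
  rewrite Rinv_1, Rmult_1_l in H. unfold theta3, prodA, prodC. lra.
Qed.

Lemma theta4_prod (q : R) : 0 < q < 1 -> theta4 q = prodA q * prodD q ^ 2.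
Proof.
  intro Hq.
  assert (E : / -1 = -1) by lra.
  pose proof (jacobi_triple_product q (-1) Hq ltac:(lra) ltac:(lra) ltac:(lra)) as H.
  rewrite E in H. replace (-1 * q) with (- q) in H by ring.
  unfold theta4, prodA, prodD. lra.
Qed.

(** This is theta_2(q)^2 = 2 theta_2(q^2) theta_3(q^2): both sides lose the same power q^(1/2). *)
Lemma theta2_red_landen (q : R) :
  0 < q < 1 -> theta2_red q ^ 2 = 2 * theta2_red (q ^ 2) * theta3 (q ^ 2).
Proof.
  intro Hq. assert (Hq2 : 0 < q ^ 2 < 1) by nra.
  rewrite !theta2_red_prod, theta3_prod by assumption.
  rewrite <- (prodAB q) by assumption.
  transitivity (4 * prodA q ^ 2 * prodB q ^ 2 * prodB q ^ 2); [ring|].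
  rewrite (prodB_split q) at 2 by assumption. ring.
Qed.

Lemma theta_pos (q : R) : 0 < q < 1 -> 0 < theta2_red q /\ 0 < theta3 q /\ 0 < theta4 q.
Proof.
  intro Hq. destruct (prod_pos q Hq) as (HA & HB & HC & HD).
  rewrite theta2_red_prod, theta3_prod, theta4_prod by assumption.
  repeat split; repeat apply Rmult_lt_0_compat; try apply pow_lt; lra.
Qed.

Lemma theta_bounds (q : R) :
  0 < q <= / 2 -> 1 <= theta3 q <= 1 + 4 * q /\ 2 <= theta2_red q <= 4.
Proof.
  intro Hq.
  pose proof (theta_half_bounds q 1 ltac:(lra) ltac:(lra)).
  pose proof (theta_half_bounds q q ltac:(lra) ltac:(lra)).
  (* Here q <= 1/2 enters: (1 - q)(1 + 2q) = 1 + q (1 - 2q). *)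
  assert (/ (1 - q) <= 1 + 2 * q).
  { apply Rmult_le_reg_l with (1 - q); [lra|]. rewrite Rinv_r by lra. nra. }
  unfold theta3, theta2_red. lra.
Qed.

(** * Iterated squaring of q and the quadratic theta relations *)

Lemma pow_pow2_succ (q : R) (n : nat) : q ^ (2 ^ S n) = (q ^ (2 ^ n)) ^ 2.
Proof. rewrite <- pow_mult. f_equal. simpl. lia. Qed.

Lemma pow_pow2_range (q : R) (n : nat) : 0 < q < 1 -> 0 < q ^ (2 ^ n) < 1.
Proof.
  intro Hq. induction n as [|n IH]; [simpl; lra|]. rewrite pow_pow2_succ. nra.
Qed.

Lemma is_lim_seq_pow_pow2 (q : R) : 0 < q < 1 -> is_lim_seq (fun n => q ^ (2 ^ n)) 0.
Proof.
  intro Hq. apply (is_lim_seq_subseq (fun n => q ^ n) 0 (fun n => 2 ^ n)%nat).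
  - apply eventually_subseq. intro n. simpl. pose proof (Nat.pow_nonzero 2 n). lia.
  - apply is_lim_seq_geom. rewrite Rabs_pos_eq; lra.
Qed.

Lemma eventually_small (u : nat -> R) : is_lim_seq u 0 -> eventually (fun n => u n <= / 2).
Proof.
  intro H. apply is_lim_seq_spec in H.
  destruct (H (mkposreal (/ 2) ltac:(lra))) as [N HN]. exists N. intros n Hn.
  specialize (HN n Hn). simpl in HN. apply Rabs_def2 in HN. lra.
Qed.

(* The theta relations give [defect q = - defect (q ^ 2)], and [defect]
   tends to [0] at [0]. *)
Lemma theta3_sq_split (q : R) :
  0 < q < 1 -> theta3 q ^ 2 = theta3 (q ^ 2) ^ 2 + q * theta2_red (q ^ 2) ^ 2.
Proof.
  intro Hq.
  set (defect := fun q => theta3 q ^ 2 - theta3 (q ^ 2) ^ 2 - q * theta2_red (q ^ 2) ^ 2).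
  assert (Hrec : forall q, 0 < q < 1 -> defect q = - defect (q ^ 2)).
  { clear q Hq. intros q Hq. unfold defect.
    pose proof (theta34_plus q Hq) as H1. pose proof (theta34_minus q Hq) as H2.
    pose proof (theta2_red_landen (q ^ 2) ltac:(nra)) as H3.
    replace ((q ^ 2) ^ 2) with (q ^ 4) in * by ring. rewrite H3.
    (* On squaring, the cross term equals q theta2_red(q^2)^2 by H3 and cancels; the two squares
       that remain are those of [defect (q ^ 2)]. *)
    replace (theta3 q) with (theta3 (q ^ 4) + q * theta2_red (q ^ 4)) by lra. ring. }
  assert (Hn : forall n, Rabs (defect (q ^ (2 ^ n))) = Rabs (defect q)).
  { induction n as [|n IH]; [now rewrite pow_1|].
    rewrite <- IH, (Hrec (q ^ (2 ^ n))), Rabs_Ropp by now apply pow_pow2_range.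
    now rewrite pow_pow2_succ. }
  assert (Hsmall : forall p, 0 < p <= / 2 -> Rabs (defect p) <= 40 * p).
  { intros p Hp. assert (Hp2 : 0 < p ^ 2 <= / 2 /\ p ^ 2 <= p / 2) by nra.
    pose proof (theta_bounds p Hp) as [B1 _]. pose proof (theta_bounds (p ^ 2) (proj1 Hp2)) as [B2 B3].
    assert (1 <= theta3 p ^ 2 <= 1 + 16 * p) by nra.
    assert (1 <= theta3 (p ^ 2) ^ 2 <= 1 + 16 * p ^ 2) by nra.
    assert (0 <= theta2_red (p ^ 2) ^ 2 <= 16) by nra.
    assert (0 <= p * theta2_red (p ^ 2) ^ 2 <= 16 * p) by nra.
    apply Rabs_le. unfold defect. lra. }
  assert (H : Rbar_le (Rabs (defect q)) 0).
  { apply (is_lim_seq_le_loc (fun _ => Rabs (defect q)) (fun n => 40 * q ^ (2 ^ n))).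
    - pose proof (is_lim_seq_pow_pow2 q Hq) as HL. destruct (eventually_small _ HL) as [N HN].
      exists N. intros n Hle. rewrite <- (Hn n). apply Hsmall.
      split; [now apply pow_pow2_range | now apply HN].
    - apply is_lim_seq_const.
    - replace (Finite 0) with (Rbar_mult 40 0) by (simpl; f_equal; ring).
      now apply is_lim_seq_scal_l, is_lim_seq_pow_pow2. }
  simpl in H. assert (E : defect q = 0).
  { apply Rabs_eq_0. pose proof (Rabs_pos (defect q)). lra. }
  unfold defect in E. lra.
Qed.

Lemma theta34_sq_minus (q : R) :
  0 < q < 1 -> theta3 q ^ 2 - theta4 q ^ 2 = 2 * q * theta2_red (q ^ 2) ^ 2.
Proof.
  intro Hq.
  pose proof (theta34_plus q Hq) as H1. pose proof (theta34_minus q Hq) as H2.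
  pose proof (theta2_red_landen (q ^ 2) ltac:(nra)) as H3.
  replace ((q ^ 2) ^ 2) with (q ^ 4) in * by ring. rewrite H3.
  transitivity ((theta3 q + theta4 q) * (theta3 q - theta4 q)); [ring|].
  rewrite H1, H2. ring.
Qed.

Lemma theta34_sq_plus (q : R) :
  0 < q < 1 -> theta3 q ^ 2 + theta4 q ^ 2 = 2 * theta3 (q ^ 2) ^ 2.
Proof.
  intro Hq. pose proof (theta34_sq_minus q Hq). pose proof (theta3_sq_split q Hq). lra.
Qed.

(** [sqrt q] restores the square of the factor q^(1/4) left out of [theta2_red]. *)
Definition modulus (q : R) : R := sqrt q * theta2_red q ^ 2 / theta3 q ^ 2.
Definition comodulus (q : R) : R := theta4 q ^ 2 / theta3 q ^ 2.

Lemma comodulus_pos (q : R) : 0 < q < 1 -> 0 < comodulus q.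
Proof.
  intro Hq. destruct (theta_pos q Hq) as (H2 & H3 & H4).
  apply Rdiv_lt_0_compat; now apply pow_lt.
Qed.

Lemma modulus_pos (q : R) : 0 < q < 1 -> 0 < modulus q.
Proof.
  intro Hq. destruct (theta_pos q Hq) as (H2 & H3 & H4).
  apply Rdiv_lt_0_compat; [apply Rmult_lt_0_compat|]; try now apply pow_lt.
  apply sqrt_lt_R0; lra.
Qed.

(** Jacobi's theta_3^4 = theta_2^4 + theta_4^4: factor theta_3^4 - theta_4^4 and apply the relations
    for theta_3^2 + theta_4^2 and theta_3^2 - theta_4^2. *)
Lemma modulus_comodulus (q : R) : 0 < q < 1 -> modulus q ^ 2 + comodulus q ^ 2 = 1.
Proof.
  intro Hq. destruct (theta_pos q Hq) as (H2 & H3 & H4).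
  assert (E : q * theta2_red q ^ 4 = theta3 q ^ 4 - theta4 q ^ 4).
  { transitivity ((theta3 q ^ 2 + theta4 q ^ 2) * (theta3 q ^ 2 - theta4 q ^ 2)); [|ring].
    rewrite theta34_sq_plus, theta34_sq_minus by assumption.
    replace (theta2_red q ^ 4) with ((theta2_red q ^ 2) ^ 2) by ring.
    rewrite theta2_red_landen by assumption. ring. }
  unfold modulus, comodulus.
  transitivity ((sqrt q ^ 2 * theta2_red q ^ 4 + theta4 q ^ 4) / theta3 q ^ 4); [field; lra|].
  rewrite pow2_sqrt, E by lra. field. lra.
Qed.

Lemma modulus_range (q : R) : 0 < q < 1 -> 0 < modulus q < 1.
Proof.
  intro Hq. pose proof (modulus_pos q Hq). pose proof (comodulus_pos q Hq).
  pose proof (modulus_comodulus q Hq). split; [assumption|]. nra.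
Qed.

Lemma modulus_landen (q : R) :
  0 < q < 1 -> modulus (q ^ 2) = (1 - comodulus q) / (1 + comodulus q).
Proof.
  intro Hq. destruct (theta_pos q Hq) as (H2 & H3 & H4).
  destruct (theta_pos (q ^ 2) ltac:(nra)) as (_ & H3' & _).
  pose proof (theta34_sq_minus q Hq) as Hm. pose proof (theta34_sq_plus q Hq) as Hp.
  assert (0 < theta3 q ^ 2 /\ 0 < theta4 q ^ 2) by (split; now apply pow_lt).
  transitivity ((theta3 q ^ 2 - theta4 q ^ 2) / (theta3 q ^ 2 + theta4 q ^ 2)).
  - rewrite Hm, Hp. unfold modulus. rewrite sqrt_pow2 by lra. field. lra.
  - unfold comodulus. field. repeat split; nra.
Qed.

(** * The ratio K'/K and its evaluation *)

Definition period_ratio (k : R) : R := hyp (1 - k ^ 2) / hyp (k ^ 2).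

(** Landen's transformation is applied twice: at x it relates K at x and k, at c it relates K' at k
    and x. The factor 2 is (1 + x)(1 + c). *)
Lemma period_ratio_double (q : R) :
  0 < q < 1 -> period_ratio (modulus (q ^ 2)) = 2 * period_ratio (modulus q).
Proof.
  intro Hq. pose proof (modulus_range q Hq) as Hk. pose proof (comodulus_pos q Hq) as Hc.
  pose proof (modulus_comodulus q Hq) as Hkc.
  pose proof (modulus_range (q ^ 2) ltac:(nra)) as Hx.
  pose proof (modulus_landen q Hq) as HL. unfold period_ratio.
  set (k := modulus q) in *. set (c := comodulus q) in *. set (x := modulus (q ^ 2)) in *.
  assert (Hc1 : c < 1) by nra.
  pose proof (hyp_landen x ltac:(lra)) as E1. pose proof (hyp_landen c ltac:(lra)) as E2.
  replace (4 * x / (1 + x) ^ 2) with (k ^ 2) in E1.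
  2:{ replace (k ^ 2) with (1 - c ^ 2) by lra. rewrite HL. field. lra. }
  replace (4 * c / (1 + c) ^ 2) with (1 - x ^ 2) in E2 by (rewrite HL; field; lra).
  replace (c ^ 2) with (1 - k ^ 2) in E2 by lra.
  rewrite E1, E2. pose proof (hyp_ge_1 (x ^ 2) ltac:(nra)).
  replace (1 + c) with (2 / (1 + x)) by (rewrite HL; field; lra).
  field. lra.
Qed.

(** The logarithm in the growth bounds is 2 ln k, and k equals sqrt q up to a factor between 1/16
    and 16. That the error does not depend on q is the point. *)
Lemma hyp_comodulus_bound (q : R) :
  0 < q <= / 2 -> Rabs (hyp (1 - modulus q ^ 2) + ln q / PI) <= 1 + 2 * ln 16 / PI.
Proof.
  intro Hq. pose proof PI_RGT_0 as Hpi.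
  pose proof (modulus_range q ltac:(lra)) as Hk.
  pose proof (hyp_ln_lower (1 - modulus q ^ 2) ltac:(nra)) as HL.
  pose proof (hyp_ln_upper (1 - modulus q ^ 2) ltac:(nra)) as HU.
  replace (1 - (1 - modulus q ^ 2)) with (modulus q * modulus q) in * by ring.
  rewrite ln_mult in * by lra.
  destruct (theta_bounds q Hq) as [B3 B2].
  assert (Hs : 0 < sqrt q) by (apply sqrt_lt_R0; lra).
  assert (Hln : 2 * ln (sqrt q) = ln q).
  { replace q with (sqrt q * sqrt q) at 2 by (apply sqrt_sqrt; lra).
    rewrite ln_mult by assumption. ring. }
  assert (Hk1 : modulus q <= 16 * sqrt q).
  { unfold modulus. apply Rle_div_l; [nra|].
    assert (theta2_red q ^ 2 <= 16 * theta3 q ^ 2) by nra. nra. }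
  (* For q <= 1/2, theta_3 <= 3 and [theta2_red q] >= 2, so the quotient of squares is at least
     4/9. *)
  assert (Hk2 : sqrt q * / 16 <= modulus q).
  { unfold modulus. apply -> Rle_div_r; [|apply pow_lt; lra].
    assert (theta3 q ^ 2 <= 9) by nra. assert (4 <= theta2_red q ^ 2) by nra.
    rewrite Rmult_assoc. apply Rmult_le_compat_l; lra. }
  assert (H16 : 0 < ln 16) by (rewrite <- ln_1; apply ln_increasing; lra).
  assert (L1 : ln (modulus q) <= ln 16 + ln (sqrt q)).
  { rewrite <- ln_mult by lra. apply ln_le; lra. }
  assert (L2 : ln (sqrt q) - ln 16 <= ln (modulus q)).
  { rewrite <- ln_div by lra. apply ln_le; [apply Rdiv_lt_0_compat; lra | assumption]. }
  assert (Hi : 0 < / PI) by now apply Rinv_0_lt_compat.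
  unfold Rdiv in *. apply Rabs_le. split; nra.
Qed.

Lemma hyp_modulus_lim (q : R) :
  0 < q < 1 -> is_lim_seq (fun n => hyp (modulus (q ^ (2 ^ n)) ^ 2)) 1.
Proof.
  intro Hq. pose proof (is_lim_seq_pow_pow2 q Hq) as HL.
  (* 512 p <= 1/2 keeps 256 p, the bound on k^2, at most 1/4, and also gives p <= 1/2 for
     [theta_bounds]. *)
  assert (HL' : is_lim_seq (fun n => 512 * q ^ (2 ^ n)) 0).
  { replace (Finite 0) with (Rbar_mult 512 0) by (simpl; f_equal; ring).
    now apply is_lim_seq_scal_l. }
  apply (is_lim_seq_le_le_loc (fun _ => 1) _ (fun n => / (1 - 256 * q ^ (2 ^ n)))).
  - destruct (eventually_small _ HL') as [N HN]. exists N. intros n Hn. specialize (HN n Hn).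
    pose proof (pow_pow2_range q n Hq) as Hr. set (p := q ^ (2 ^ n)) in *.
    pose proof (modulus_range p Hr) as Hk.
    destruct (theta_bounds p ltac:(lra)) as [B3 B2].
    assert (Hm : modulus p ^ 2 <= 256 * p).
    { replace (256 * p) with ((16 * sqrt p) ^ 2)
        by (rewrite Rpow_mult_distr, pow2_sqrt by lra; ring).
      apply pow_incr. split; [lra|].
      unfold modulus. apply Rle_div_l; [nra|].
      pose proof (sqrt_pos p). assert (theta2_red p ^ 2 <= 16 * theta3 p ^ 2) by nra. nra. }
    split; [apply hyp_ge_1; nra|].
    eapply Rle_trans; [apply hyp_le_geom; nra|]. apply Rinv_le_contravar; lra.
  - apply is_lim_seq_const.
  - replace 1 with (/ (1 - 256 * 0)) at 1 by field.
    apply (is_lim_seq_inv _ (1 - 256 * 0)).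
    + apply is_lim_seq_minus'; [apply is_lim_seq_const|].
      now apply (is_lim_seq_scal_l _ 256 0).
    + intro E. injection E. lra.
Qed.

Lemma period_ratio_modulus (q : R) : 0 < q < 1 -> period_ratio (modulus q) = - ln q / PI.
Proof.
  intro Hq. pose proof PI_RGT_0 as Hpi.
  assert (Hn : forall n, period_ratio (modulus (q ^ (2 ^ n))) = 2 ^ n * period_ratio (modulus q)).
  { induction n as [|n IH]; [rewrite pow_1; simpl; ring|].
    rewrite pow_pow2_succ, period_ratio_double, IH by now apply pow_pow2_range. simpl. ring. }
  set (M := 1 + 2 * ln 16 / PI).
  (* 2^n v(n) is the quantity bounded by M in [hyp_comodulus_bound] at q^(2^n), so v tends to 0; its
     other limit contains the unknown ratio. *)
  set (v := fun n => period_ratio (modulus q) * hyp (modulus (q ^ (2 ^ n)) ^ 2) + ln q / PI).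
  assert (Hv : is_lim_seq v (period_ratio (modulus q) * 1 + ln q / PI)).
  { apply is_lim_seq_plus'; [|apply is_lim_seq_const].
    apply (is_lim_seq_scal_l _ _ 1). now apply hyp_modulus_lim. }
  assert (Hv0 : is_lim_seq v 0).
  { apply is_lim_seq_abs_0.
    apply (is_lim_seq_le_le_loc (fun _ => 0) _ (fun n => M * (/ 2) ^ n)).
    - destruct (eventually_small _ (is_lim_seq_pow_pow2 q Hq)) as [N HN].
      exists N. intros n Hle. split; [apply Rabs_pos|].
      pose proof (pow_pow2_range q n Hq) as Hr.
      pose proof (hyp_comodulus_bound (q ^ (2 ^ n)) (conj (proj1 Hr) (HN n Hle))) as HB.
      pose proof (modulus_range _ Hr) as Hk.
      pose proof (hyp_ge_1 (modulus (q ^ (2 ^ n)) ^ 2) ltac:(nra)) as H1.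
      assert (E : hyp (1 - modulus (q ^ (2 ^ n)) ^ 2) + ln (q ^ (2 ^ n)) / PI = 2 ^ n * v n).
      { replace (hyp (1 - modulus (q ^ (2 ^ n)) ^ 2))
          with (period_ratio (modulus (q ^ (2 ^ n))) * hyp (modulus (q ^ (2 ^ n)) ^ 2))
          by (unfold period_ratio; field; lra).
        rewrite Hn, ln_pow, pow_INR by lra. unfold v. simpl (INR 2).
        replace (1 + 1) with 2 by ring. field. lra. }
      rewrite E, Rabs_mult in HB.
      assert (Hp : 0 < 2 ^ n) by (apply pow_lt; lra).
      rewrite (Rabs_pos_eq (2 ^ n)) in HB by lra. fold M in HB.
      rewrite pow_inv. apply Rmult_le_reg_l with (2 ^ n); [assumption|].
      replace (2 ^ n * (M * / 2 ^ n)) with M by (field; lra). assumption.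
    - apply is_lim_seq_const.
    - replace (Finite 0) with (Rbar_mult M 0) by (simpl; f_equal; ring).
      apply is_lim_seq_scal_l, is_lim_seq_geom. rewrite Rabs_pos_eq; lra. }
  pose proof (is_lim_seq_eq _ _ _ Hv Hv0). unfold Rdiv in *. lra.
Qed.

Lemma period_ratio_decreasing (k1 k2 : R) :
  0 < k1 -> k1 < k2 -> k2 < 1 -> period_ratio k2 < period_ratio k1.
Proof.
  intros H1 H12 H2. unfold period_ratio.
  pose proof (hyp_increasing (k1 ^ 2) (k2 ^ 2) ltac:(nra) ltac:(nra) ltac:(nra)).
  pose proof (hyp_increasing (1 - k2 ^ 2) (1 - k1 ^ 2) ltac:(nra) ltac:(nra) ltac:(nra)).
  pose proof (hyp_ge_1 (k1 ^ 2) ltac:(nra)). pose proof (hyp_ge_1 (1 - k2 ^ 2) ltac:(nra)).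
  apply Rlt_div_l; [lra|].
  replace (hyp (1 - k1 ^ 2) / hyp (k1 ^ 2) * hyp (k2 ^ 2))
    with (hyp (1 - k1 ^ 2) * hyp (k2 ^ 2) / hyp (k1 ^ 2)) by (field; lra).
  apply Rlt_div_r; nra.
Qed.

Lemma ellK_ratio (k : R) :
  0 < k < 1 -> ellK (sqrt (1 - k ^ 2)) / ellK k = period_ratio k.
Proof.
  intro Hk. unfold ellK, period_ratio. fold (hyp (sqrt (1 - k ^ 2) ^ 2)) (hyp (k ^ 2)).
  rewrite pow2_sqrt by nra.
  pose proof (hyp_ge_1 (k ^ 2) ltac:(nra)). pose proof PI_RGT_0. field. lra.
Qed.

Lemma singular_modulus_modulus (r : R) :
  0 < r -> singular_modulus r = modulus (exp (- PI * sqrt r)).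
Proof.
  intro Hr. pose proof PI_RGT_0 as Hpi.
  assert (Hs : 0 < sqrt r) by now apply sqrt_lt_R0.
  set (q := exp (- PI * sqrt r)).
  assert (Hq : 0 < q < 1).
  { split; [apply exp_pos|]. rewrite <- exp_0. apply exp_increasing. nra. }
  assert (Hk := modulus_range q Hq).
  assert (Hmod : is_singular_modulus r (modulus q)).
  { split; [assumption|]. rewrite ellK_ratio, period_ratio_modulus by assumption.
    unfold q. rewrite ln_exp. field. lra. }
  assert (Huniq : forall k, is_singular_modulus r k -> modulus q = k).
  { intros k [Hk0 Ek]. destruct Hmod as [_ Em].
    rewrite ellK_ratio in Ek, Em by assumption.
    destruct (Rtotal_order (modulus q) k) as [H|[H|H]]; [|assumption|];
      apply period_ratio_decreasing in H; lra. }
  symmetry. apply Huniq. unfold singular_modulus.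
  apply (iota_correct (V := R_CompleteNormedModule)). exists (modulus q). now split.
Qed.

(** * Product form of both sides and conclusion *)

Lemma modulus_prod (q : R) :
  0 < q < 1 -> 4 * (1 - modulus q ^ 2) / modulus q = prodD q ^ 12 / sqrt q.
Proof.
  intro Hq. destruct (prod_pos q Hq) as (HA & HB & HC & HD).
  pose proof (prodBCD q Hq) as E.
  assert (Hs : 0 < sqrt q) by (apply sqrt_lt_R0; lra).
  replace (1 - modulus q ^ 2) with (comodulus q ^ 2)
    by (pose proof (modulus_comodulus q Hq); lra).
  unfold modulus, comodulus.
  rewrite theta2_red_prod, theta3_prod, theta4_prod by assumption.
  (* Here k'^2 = D^8 / C^8 and k = 4 sqrt q B^4 / C^4; Euler's BCD = 1 trades 1 / (B C)^4 for
     D^4. *)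
  transitivity (prodD q ^ 12 / (sqrt q * (prodB q * prodC q * prodD q) ^ 4)).
  - field. lra.
  - rewrite E. field. lra.
Qed.

(** The twelfth root of q^(-1/2) is q^(-1/24), which the prefactor cancels. *)
Lemma Rpower_modulus (q : R) :
  0 < q < 1 ->
  Rpower q (1 / 24) * Rpower (4 * (1 - modulus q ^ 2) / modulus q) (1 / 12) = prodD q.
Proof.
  intro Hq. destruct (prod_pos q Hq) as (_ & _ & _ & HD).
  rewrite modulus_prod by assumption.
  replace (prodD q ^ 12 / sqrt q) with (exp (12 * ln (prodD q) - ln q / 2)).
  - unfold Rpower. rewrite ln_exp, <- exp_plus.
    replace (1 / 24 * ln q + 1 / 12 * (12 * ln (prodD q) - ln q / 2)) with (ln (prodD q)) by field.
    now apply exp_ln.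
  - unfold Rminus. rewrite exp_plus, exp_Ropp. unfold Rdiv. f_equal.
    + rewrite <- Rpower_pow by assumption. unfold Rpower. do 2 f_equal. simpl. ring.
    + rewrite <- Rpower_sqrt by lra. unfold Rpower. do 2 f_equal. ring.
Qed.

(** The triple product with base q^2 and z = - q. Its two outer products run over the exponents 3
    and 1 modulo 4, and together form the product over odd exponents. *)
Lemma theta_series_prod (q : R) :
  0 < q < 1 ->
  theta_half (q ^ 2) (- q) + theta_half (q ^ 2) (- / q) - 1 = eta (q ^ 4) * prodD q.
Proof.
  intro Hq.
  assert (E : / - q = - / q) by (field; lra).
  assert (E1 : - / q * q ^ 2 = - q) by (field; lra).
  pose proof (jacobi_triple_product (q ^ 2) (- q) ltac:(nra) ltac:(lra) ltac:(nra)) as H.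
  rewrite E, E1 in H. rewrite H by lra.
  replace ((q ^ 2) ^ 2) with (q ^ 4) by ring. rewrite eta_qinf.
  unfold prodD. rewrite (qinf_double (- q) (q ^ 2)) by nra.
  replace ((q ^ 2) ^ 2) with (q ^ 4) by ring. ring.
Qed.

Theorem theorem1 (r : R) (hr : 0 < r) :
  let q := exp (- PI * sqrt r) in
  let k := singular_modulus r in
  is_series_Z (fun n : Z => powerRZ (-1) n * powerRZ q (2 * n ^ 2 + n)%Z)
    (Rpower q (1 / 24) * eta (q ^ 4) * Rpower (4 * (1 - k ^ 2) / k) (1 / 12)).
Proof.
  intros q k.
  assert (Hq : 0 < q < 1).
  { split; [apply exp_pos|]. rewrite <- exp_0. apply exp_increasing.
    pose proof PI_RGT_0. pose proof (sqrt_lt_R0 r hr). nra. }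
  unfold k. rewrite singular_modulus_modulus by assumption. fold q.
  (* The half-series over negative n starts at -1, so the term n = 0 is removed from the second
     witness. *)
  exists (theta_half (q ^ 2) (- q)), (theta_half (q ^ 2) (- / q) - 1).
  assert (Hterm : forall z : Z,
    powerRZ (-1) z * powerRZ q (2 * z ^ 2 + z) =
    (q ^ 2) ^ (Z.abs_nat z * Z.abs_nat z) * powerRZ (- q) z).
  { intro z. rewrite powerRZ_add by lra.
    replace (- q) with (-1 * q) by ring. rewrite powerRZ_mult.
    rewrite <- pow_mult, pow_powerRZ.
    replace (Z.of_nat (2 * (Z.abs_nat z * Z.abs_nat z))) with (2 * z ^ 2)%Z by nia. ring. }
  assert (Hq2 : 0 < q ^ 2 < 1) by nra.
  split; [|split].
  - eapply is_series_ext; [|apply (is_series_theta_half (q ^ 2) (- q)); lra].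
    intro n. cbv beta. rewrite Hterm, Zabs2Nat.id, <- pow_powerRZ. reflexivity.
  - apply (is_series_ext (fun n => (fun n => (q ^ 2) ^ (n * n) * (- / q) ^ n) (S n))).
    { intro n. rewrite Hterm, powerRZ_neg', <- pow_powerRZ, <- pow_inv.
      replace (Z.abs_nat (- Z.of_nat (S n))) with (S n) by lia.
      do 2 f_equal. field. lra. }
    apply (is_series_incr_1 (V := R_NormedModule) (fun n => (q ^ 2) ^ (n * n) * (- / q) ^ n)).
    replace (plus _ _) with (theta_half (q ^ 2) (- / q)) by (unfold plus; simpl; ring).
    apply is_series_theta_half; [assumption|].
    apply Ropp_neq_0_compat, Rinv_neq_0_compat; lra.
  - replace (theta_half (q ^ 2) (- q) + (theta_half (q ^ 2) (- / q) - 1))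
      with (eta (q ^ 4) * prodD q) by (rewrite <- theta_series_prod by assumption; ring).
    rewrite <- (Rpower_modulus q Hq) at 1. ring.
Qed.
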